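(* There exists a complete orthonormal system $\{\theta_n\}_{n=1}^\infty$ in $L^2_{[0,1]}$ that is uniformly bounded, i.e. $\sup_n\|\theta_n\|_{L^\infty_{[0,1]}}<\infty$, for which the following assertion is false: for every measurable, almost everywhere finite function $f$ on $[0,1]$ there is a sequence of real coefficients $\{a_n\}_{n=1}^\infty$ such that the series $\sum_{n=1}^\infty a_n\theta_n(x)$ converges to $f(x)$ for almost every $x\in[0,1]$.
   Context: Functions and coefficients are real-valued; $[0,1]$ carries Lebesgue measure. Complete means that the closed linear span is all of $L^2_{[0,1]}$. *)

(* Defs.v *)
From HB Require Import structures.
From mathcomp Require Import all_boot all_order all_algebra.
From mathcomp Require Import all_classical all_reals all_analysis.
From mathcomp Require Import measurable_realfun.

Set Implicit Arguments.
Unset Strict Implicit.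
Unset Printing Implicit Defensive.

Import Order.TTheory GRing.Theory Num.Theory.
Import numFieldNormedType.Exports.

Local Open Scope classical_set_scope.
Local Open Scope ring_scope.

(* The space [0,1] is rendered as the real line with Lebesgue measure           *)
(* restricted to [0,1]: the complement of [0,1] is then a null set, so values   *)
(* outside [0,1] play no role in integrals, norms and a.e. statements.          *)
(* Measurability is Borel measurability, and a null set is any subset of a      *)
(* Borel set of measure 0; as a Lebesgue measurable function agrees a.e. with a *)
(* Borel one, the function classes are the usual ones up to a.e. equality.      *)
Definition lebesgue01 (R : realType) : set (measurableTypeR R) -> \bar R :=
  mrestr (@lebesgue_measure R) (measurable_itv `[0, 1]).

HB.instance Definition _ (R : realType) := Measure.on (@lebesgue01 R).

Section systems.
Variable R : realType.
Local Notation T := (measurableTypeR R).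
Local Notation mu := (@lebesgue01 R).
Implicit Types (theta : nat -> T -> R) (a : nat -> R).

Definition orthonormal_system theta : Prop :=
  (forall n, theta n \in Lfun mu 2%:E) /\
  (forall m n,
     (\int[mu]_x (theta m x * theta n x)%:E = ((m == n)%:R)%:E)%E).

Definition linear_span theta : set (T -> R) :=
  [set g | exists N a, g = (fun x => \sum_(n < N) a n * theta n x)].

Definition closed_linear_span theta : set (T -> R) :=
  [set h | h \in Lfun mu 2%:E /\
     forall eps : R, 0 < eps ->
       exists2 g, linear_span theta g &
         ('N[mu]_2%:E [EFin \o (h \- g)%R] < eps%:E)%E].

Definition complete_system theta : Prop :=
  closed_linear_span theta = [set h | h \in Lfun mu 2%:E].

Definition uniformly_bounded theta : Prop :=
  (ereal_sup [set 'N[mu]_+oo [EFin \o theta n] | n in [set: nat]] < +oo)%E.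

(* Since f is a.e. finite, convergence in the extended reals to f x is, for a.e. *)
(* x, ordinary convergence to a real number.                                    *)
Definition represents_all_measurable theta : Prop :=
  forall f : T -> \bar R,
    measurable_fun (`[0, 1]%classic : set T) f ->
    {ae mu, forall x, f x \is a fin_num} ->
    exists a, {ae mu, forall x,
      (fun N => (series (fun n => a n * theta n x) N)%:E) @ \oo --> f x}.

End systems.

(* Main.v *)
Require Import Defs.
From HB Require Import structures.
From mathcomp Require Import all_boot all_order all_algebra.
From mathcomp Require Import all_classical all_reals all_analysis.
From mathcomp Require Import measurable_realfun ess_sup_inf.
From mathcomp Require Import ring lra zify.

(* The system is made of blocks of bounded functions of the binary digits of [x].
   Block [k] is a Haar rotation of size [4 ^ L], of Olevskii type, applied to one
   odd Walsh function and to functions even in the first digit. The full sum of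
   a block contains that Walsh function with a coefficient [c], the scaled sum of
   the coefficients of the block. If [c] is not too small and [L] is large, then
   with probability at least a constant times [c ^ 2], given the digits of the
   earlier blocks, some partial sum inside the block exceeds 1 in absolute value.
   Almost everywhere convergence thus forces the sum of the [c ^ 2] over all
   blocks to be finite. Flipping the first digit, that is translating by 1/2,
   isolates the odd Walsh functions: if the series represents [f], then
   [f x - f (x + 1/2)] is twice the square summable Walsh series with
   coefficients [c]. This fails for [f x = 1 / x]. *)

Set Implicit Arguments.
Unset Strict Implicit.
Unset Printing Implicit Defensive.

Import Order.TTheory GRing.Theory Num.Theory.
Import numFieldNormedType.Exports.

Local Open Scope ring_scope.

(** * Averages and stopped martingales on a binary tree *)

(** Menshov's theorem represents every such function by a trigonometric series, so boundedness and
    completeness alone do not obstruct representation: pointwise convergence has to be made to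
    control the coefficients. At a given point each low Haar level of a block has one active cell
    and its own random sign. A partial sum is therefore a Rademacher sum plus a term fixed by
    earlier digits, and moment bounds make it exceed 1 with probability at least 1/12 as soon as its
    coefficients have square sum at least 2. For the full block sum these coefficients are scaled
    half-differences of the series coefficients over dyadic cells. This is not enough: if all series
    coefficients of the block are equal, every half-difference is 0 and the mean [c] goes
    undetected. Cutting the sum at the index that corresponds to the cell of the point itself closes
    this escape, and a cut index that depends only on the cell stays independent of the signs. *)

Section tree.
Variable R : realFieldType.
Implicit Types (l m n v : nat) (F G : nat -> R).

Definition sg (b : bool) : R := (-1) ^+ b.

Lemma sg_sqr b : sg b ^+ 2 = 1.
Proof. by rewrite /sg -exprM mulnC exprM sqrrN !expr1n. Qed.

(* Average over the [2 ^ l] vertices of level [l] of the binary tree in which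
   the children of [v] are [2 v] and [2 v + 1]. *)
Fixpoint tavg l F : R :=
  if l is l'.+1 then tavg l' (fun v => (F v.*2 + F v.*2.+1) / 2) else F 0%N.

Lemma eq_tavg l F G : F =1 G -> tavg l F = tavg l G.
Proof. by elim: l F G => [|l IH] F G FG /=; rewrite ?FG//; apply: IH => v; rewrite !FG. Qed.

Lemma tavgD l F G : tavg l (fun v => F v + G v) = tavg l F + tavg l G.
Proof.
elim: l F G => [//|l IH] F G /=; rewrite -IH; apply: eq_tavg => v; by field.
Qed.

Lemma tavgZ l (a : R) F : tavg l (fun v => a * F v) = a * tavg l F.
Proof.
elim: l F => [//|l IH] F /=; rewrite -IH; apply: eq_tavg => v; by field.
Qed.

Lemma tavg_cst l (a : R) : tavg l (fun=> a) = a.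
Proof. by elim: l => [//|l IH] /=; rewrite -[RHS]IH; apply: eq_tavg => v; field. Qed.

Lemma ler_tavg l F G : (forall v, (v < 2 ^ l)%N -> F v <= G v) -> tavg l F <= tavg l G.
Proof.
elim: l F G => [|l IH] F G FG /=; first exact: FG.
by apply: IH => v hv; rewrite ler_pM2r ?invr_gt0 ?ltr0n// lerD ?FG// expnS; lia.
Qed.

Lemma tavg_sum l n (F : nat -> nat -> R) :
  tavg l (fun v => \sum_(i < n) F i v) = \sum_(i < n) tavg l (F i).
Proof.
elim: n => [|n IH].
  rewrite big_ord0 -[RHS](tavg_cst l); apply: eq_tavg => v; exact: big_ord0.
rewrite big_ord_recr /= -IH -tavgD; apply: eq_tavg => v; exact: big_ord_recr.
Qed.

Lemma tavg_divn l m F : tavg (l + m)%N (fun v => F (v %/ 2 ^ m)%N) = tavg l F.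
Proof.
elim: m F => [|m IH] F; first by rewrite addn0; apply: eq_tavg => v; rewrite divn1.
rewrite addnS /= -IH; apply: eq_tavg => v.
have -> : (v.*2.+1 %/ 2 ^ m.+1 = v %/ 2 ^ m)%N.
  by rewrite expnS divnMA divn2 /= uphalf_double.
have -> : (v.*2 %/ 2 ^ m.+1 = v %/ 2 ^ m)%N by rewrite expnS divnMA divn2 doubleK.
by field.
Qed.

Section stopped.
Variables (c : R) (dl : nat -> nat -> R).

Fixpoint sqf l v : R := if l is l'.+1 then sqf l' v./2 + dl l' v./2 ^+ 2 else 0.

(* The martingale with predictable increments [+- dl], stopped before its
   square function exceeds 2. *)
Fixpoint stm l v : R := if l is l'.+1 then
  stm l' v./2 + sg (odd v) * (dl l' v./2 * (sqf l v <= 2)%R%:R) else c.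

Lemma tavg_stm l : tavg l (stm l) = c.
Proof.
elim: l => [//|l IH]; rewrite -[RHS]IH /=; apply: eq_tavg => v.
by rewrite /= uphalf_double doubleK odd_double /= /sg expr0 expr1; field.
Qed.

Fixpoint stq l v : R := if l is l'.+1 then
  stq l' v./2 + dl l' v./2 ^+ 2 * (sqf l v <= 2)%R%:R else 0.

(** The invariant [stq <= sqf] is carried along: an increment is kept only while [sqf], its own
    square included, is at most 2. *)
Lemma stq_le2 l v : stq l v <= 2.
Proof.
suff : stq l v <= sqf l v /\ stq l v <= 2 by case.
elim: l v => [|l IH] v /=; first by rewrite lexx ler0n.
have [h1 h2] := IH v./2; have h3 := sqr_ge0 (dl l v./2).
by case: (leP (_ + _ ^+ 2) 2) => h4; rewrite ?mulr1n ?mulr0n ?mulr1 ?mulr0; split; lra.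
Qed.

(** The two increments below a vertex are opposite, so cross terms cancel and the second moment
    grows exactly by the kept squares collected in [stq]. *)
Lemma tavg_stm2 l : tavg l (fun v => stm l v ^+ 2) <= c ^+ 2 + 2.
Proof.
have -> : tavg l (fun v => stm l v ^+ 2) = tavg l (fun v => c ^+ 2 + stq l v).
  elim: l => [/=|l IH]; first by rewrite addr0.
  rewrite /=.
  transitivity (tavg l (fun v => stm l v ^+ 2 + dl l v ^+ 2 * (sqf l v + dl l v ^+ 2 <= 2)%R%:R)).
    apply: eq_tavg => v /=; rewrite uphalf_double doubleK odd_double /= /sg expr0 expr1.
    by case: (_ + _ <= 2)%R; rewrite ?mulr1n ?mulr0n; field.
  rewrite tavgD IH -tavgD; apply: eq_tavg => v /=.
  by rewrite uphalf_double doubleK; field.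
rewrite -[leRHS](tavg_cst l); apply: ler_tavg => v _; by rewrite lerD2l stq_le2.
Qed.

(* A second-moment lower bound in disguise: [2 s - s^2] is at most 1, and is
   nonpositive when [s <= 0]. *)
Definition pzf (x : R) : R :=
  let s := (x * c - c ^+ 2 / 2) / (2 * (c ^+ 2 + 2)) in 2 * s - s ^+ 2.

Let den_gt0 : 0 < 2 * (c ^+ 2 + 2).
Proof. by have := sqr_ge0 c; lra. Qed.

Lemma pzf_le1 x : pzf x <= 1.
Proof. rewrite /pzf; set s := _ / _; have := sqr_ge0 (1 - s); nra. Qed.

(** [pzf x] can be positive only if [x * c > c ^ 2 / 2]; then [4 * x ^ 2 > c ^ 2] and the bound by 1
    suffices. *)
Lemma pzf_le x : c != 0 -> pzf x <= 4 * x ^+ 2 / c ^+ 2.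
Proof.
move=> c0; have c2 : 0 < c ^+ 2 by rewrite exprn_even_gt0.
rewrite ler_pdivlMr//.
have [h|h] := leP (x * c - c ^+ 2 / 2) 0.
  apply: (@le_trans _ _ 0); last by rewrite mulr_ge0 ?sqr_ge0.
  rewrite mulr_le0_ge0 ?(ltW c2)// /pzf.
  have : (x * c - c ^+ 2 / 2) / (2 * (c ^+ 2 + 2)) <= 0.
    by rewrite mulr_le0_ge0// invr_ge0 ltW.
  set s := _ / _ => hs; have := sqr_ge0 s; lra.
have h1 := pzf_le1 x; apply: (@le_trans _ _ (c ^+ 2)).
  by rewrite ler_piMl// ltW.
nra.
Qed.

(** Only the first two moments of [stm] enter the quadratic [pzf]. Its scale [2 * (c ^ 2 + 2)] makes
    the loss from [s ^ 2] at most half of the gain [2 * s] on average. *)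
Lemma tavg_pzf l : c ^+ 2 / (4 * (c ^+ 2 + 2)) <= tavg l (fun v => pzf (stm l v)).
Proof.
have h1 := tavg_stm l; have h2 := tavg_stm2 l.
pose k := (2 * (c ^+ 2 + 2))^-1.
have -> : tavg l (fun v => pzf (stm l v)) =
    (2 * k * c + k ^+ 2 * c ^+ 3) * tavg l (stm l) +
    (- (k ^+ 2 * c ^+ 2)) * tavg l (fun v => stm l v ^+ 2) +
    tavg l (fun=> - (k * c ^+ 2 + k ^+ 2 * c ^+ 4 / 4)).
  by rewrite -!tavgZ -!tavgD; apply: eq_tavg => v; rewrite /pzf -/k; field.
rewrite tavg_cst h1; set A := tavg _ _ in h2 *.
have k0 : 0 < k by rewrite invr_gt0.
have hk : k * (2 * (c ^+ 2 + 2)) = 1 by rewrite mulVf ?gt_eqF.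
have -> : c ^+ 2 / (4 * (c ^+ 2 + 2)) = c ^+ 2 * k / 2.
  by rewrite /k; field; rewrite gt_eqF//; have := sqr_ge0 c; lra.
have hA : k ^+ 2 * c ^+ 2 * A <= k ^+ 2 * c ^+ 2 * (c ^+ 2 + 2).
  by rewrite ler_wpM2l// mulr_ge0 ?sqr_ge0.
have e1 : k ^+ 2 * c ^+ 2 * (c ^+ 2 + 2) = k * c ^+ 2 / 2.
  transitivity (k * c ^+ 2 / 2 * (k * (2 * (c ^+ 2 + 2)))); first by field.
  by rewrite hk mulr1.
have e2 : 0 <= k ^+ 2 * c ^+ 4 by rewrite mulr_ge0 ?exprn_even_ge0.
rewrite e1 in hA; nra.
Qed.

End stopped.

(* [av l v] and [dl l v] are the averages and half-differences of a function on
   the leaves of a tree with mean [c]; [D l y] is the half-difference at the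
   ancestor of level [l] of [y] once the leaves from [y] on are set to zero.
   Where the path to [y] turns left and then right, [D] and [dl] determine [av].
   So if all square sums of [D] and [dl] were small, [av] would be square
   summable along the turns, whereas the stopped martingale keeps it away from
   zero with positive probability at each of the [L] levels. *)
Section amplification.
Variables (L : nat) (c : R) (dl : nat -> nat -> R) (av : nat -> nat -> R)
  (D : nat -> nat -> R).
Hypothesis av0 : av 0%N 0%N = c.
Hypothesis avS : forall l v, (l < L.+1)%N ->
  av l.+1 v = av l v./2 + sg (odd v) * dl l v./2.

Let pre y l := (y %/ 2 ^ (L.+1 - l))%N.

Hypothesis D_turn : forall l y, (y < 2 ^ L.+1)%N -> (l < L)%N ->
  ~~ odd (pre y l.+1) -> odd (pre y l.+2) ->
  2 * D l y + D l.+1 y = av l.+1 (pre y l.+1) + dl l.+1 (pre y l.+1).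

Definition bigset y :=
  (2 <= \sum_(l < L.+1) D l y ^+ 2) || (2 <= \sum_(l < L.+1) dl l (pre y l) ^+ 2).

Lemma pre_half y l : (l < L.+1)%N -> (pre y l.+1)./2 = pre y l.
Proof.
move=> h; rewrite /pre -divn2 -divnMA mulnC -expnS; congr (_ %/ 2 ^ _)%N; lia.
Qed.

Lemma sqf_pre y l : (l <= L.+1)%N -> sqf dl l (pre y l) = \sum_(i < l) dl i (pre y i) ^+ 2.
Proof.
elim: l => [|l IH] h; first by rewrite big_ord0.
by rewrite big_ord_recr /= pre_half// IH// ltnW.
Qed.

(** Off [bigset] the square function along the path to [y] stays below 2, so the stopping never acts
    there. *)
Lemma stm_pre y l : (y < 2 ^ L.+1)%N -> ~~ bigset y -> (l <= L.+1)%N ->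
  stm c dl l (pre y l) = av l (pre y l).
Proof.
rewrite /bigset negb_or => hy /andP[_]; rewrite -ltNge => h.
elim: l => [|l IH] hl; first by rewrite /pre subn0 divn_small// av0.
rewrite avS//= pre_half// IH ?(ltnW hl)//.
have -> : (sqf dl l (pre y l) + dl l (pre y l) ^+ 2 <= 2); last by rewrite mulr1.
rewrite sqf_pre ?(ltnW hl)//.
have <- := big_ord_recr l (fun i : 'I_l.+1 => dl i (pre y i) ^+ 2).
apply: le_trans (ltW h); rewrite -!(big_mkord xpredT (fun i => dl i (pre y i) ^+ 2)).
rewrite [leRHS](big_cat_nat (n := l.+1))//=.
by rewrite lerDl sumr_ge0// => i _; exact: sqr_ge0.
Qed.

Let turn y l : R := (~~ odd (pre y l.+1) && odd (pre y l.+2))%:R.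

(** At a turn [av l] is a combination of two values of [D] and two of [dl] with coefficients 2, 1,
    -1, -1; Cauchy-Schwarz gives the factor [7 = 4 + 1 + 1 + 1]. Each of the four square sums is at
    most 2, whence [56 = 7 * 8]. *)
Lemma sum_turn y : (y < 2 ^ L.+1)%N -> ~~ bigset y ->
  \sum_(l < L) turn y l * stm c dl l (pre y l) ^+ 2 <= 56.
Proof.
move=> yL hy; have := hy; rewrite /bigset negb_or -!ltNge => /andP[h1 h2].
pose q l := D l y ^+ 2; pose r l := dl l (pre y l) ^+ 2.
have h (f : nat -> R) : (forall i, 0 <= f i) -> \sum_(l < L.+1) f l < 2 ->
    \sum_(l < L) f l <= 2 /\ \sum_(l < L) f l.+1 <= 2.
  move=> f0 hf; split; apply: le_trans (ltW hf).
    by rewrite big_ord_recr /= lerDl.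
  by rewrite big_ord_recl /= lerDr.
have [h3 h4] := h q (fun i => sqr_ge0 _) h1.
have [h5 h6] := h r (fun i => sqr_ge0 _) h2.
apply: (@le_trans _ _ (\sum_(l < L) 7 * (q l + q l.+1 + r l + r l.+1))).
  apply: ler_sum => -[l hl] _ /=; rewrite /turn.
  have q0 : 0 <= q l + q l.+1 + r l + r l.+1 by rewrite !addr_ge0// sqr_ge0.
  case: (boolP (_ && _)) => [/andP[ o1 o2] | _]; last by rewrite mul0r mulr_ge0.
  rewrite mul1r stm_pre//; last exact: leqW (ltnW hl).
  have hl' : (l < L.+1)%N by exact: leqW.
  have := D_turn yL hl o1 o2; rewrite avS// (negbTE o1) pre_half//.
  rewrite /sg expr0 mul1r /q /r => e.
  have -> : av l (pre y l) = 2 * D l y + D l.+1 y - dl l.+1 (pre y l.+1) - dl l (pre y l) by lra.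
  move: (D l y) (D l.+1 y) (dl l.+1 _) (dl l _) => x1 x2 x3 x4.
  rewrite -subr_ge0.
  have -> : 7 * (x1 ^+ 2 + x2 ^+ 2 + x4 ^+ 2 + x3 ^+ 2) - (2 * x1 + x2 - x3 - x4) ^+ 2 =
    (x1 - 2 * x2) ^+ 2 + (x1 + 2 * x3) ^+ 2 + (x1 + 2 * x4) ^+ 2 +
    (x2 + x3) ^+ 2 + (x2 + x4) ^+ 2 + (x3 - x4) ^+ 2 by ring.
  by rewrite !addr_ge0 ?sqr_ge0.
rewrite -mulr_sumr !big_split /=; lra.
Qed.

(** A turn prescribes the two bits that follow level [l], and these are independent of the ancestor
    at level [l]. *)
Lemma tavg_turn l (g : nat -> R) : (l < L)%N ->
  tavg L.+1 (fun y => turn y l * g (pre y l)) = tavg l g / 4.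
Proof.
move=> hl; pose G v := (~~ odd v./2 && odd v)%:R * g v./2./2.
transitivity (tavg L.+1 (fun y => G (y %/ 2 ^ (L.+1 - l.+2))%N)).
  by apply: eq_tavg => y; rewrite /turn /G -/(pre y l.+2) !pre_half//; lia.
have -> : (L.+1 = l.+2 + (L.+1 - l.+2))%N by lia.
rewrite addKn tavg_divn mulrC -tavgZ /=; apply: eq_tavg => v; rewrite /G.
have E w : w.*2.+1./2 = w by rewrite /= uphalf_double.
rewrite !(E, doubleK, oddS, odd_double) /= mulr0n mulr1n; by field.
Qed.

(** The sum of [pzf] over the turns is averaged in two ways. From below, each of the [L] levels
    gives a quarter of the bound of [tavg_pzf]. From above, the sum is at most [4 * 56 / c ^ 2] off
    [bigset] and at most [L] on it. *)
Lemma tavg_bigset : c != 0 -> (0 < L)%N ->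
  c ^+ 2 / (16 * (c ^+ 2 + 2)) - 224 / (c ^+ 2 * L%:R) <=
  tavg L.+1 (fun y => (bigset y)%:R).
Proof.
move=> c0 L0; set P := tavg _ _.
have c2 : 0 < c ^+ 2 by rewrite exprn_even_gt0.
have Lr : 0 < L%:R :> R by rewrite ltr0n.
have lower : L%:R * (c ^+ 2 / (16 * (c ^+ 2 + 2))) <=
    tavg L.+1 (fun y => \sum_(l < L) turn y l * pzf c (stm c dl l (pre y l))).
  rewrite (tavg_sum _ _ (fun l y => turn y l * pzf c (stm c dl l (pre y l)))).
  rewrite -[X in X%:R * _]card_ord -sumr_const mulr_suml; apply: ler_sum => -[l hl] _ /=.
  rewrite mul1r; have /= -> := tavg_turn (fun v => pzf c (stm c dl l v)) hl.
  rewrite ler_pdivlMr//; apply: le_trans (tavg_pzf c dl l).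
  rewrite le_eqVlt; apply/orP; left; apply/eqP; field.
  by rewrite gt_eqF//; have := c2; lra.
have upper : tavg L.+1 (fun y => \sum_(l < L) turn y l * pzf c (stm c dl l (pre y l)))
    <= 224 / c ^+ 2 + L%:R * P.
  rewrite /P -tavgZ -[X in X + _](tavg_cst L.+1) -tavgD; apply: ler_tavg => y yL.
  have [hy|hy] := boolP (bigset y).
    apply: (@le_trans _ _ (\sum_(l < L) 1)); last first.
      by rewrite sumr_const card_ord mulr1 lerDr divr_ge0 ?sqr_ge0 ?ler0n.
    apply: ler_sum => l _; rewrite /turn; case: (_ && _); last by rewrite mul0r.
    by rewrite mul1r pzf_le1.
  rewrite mulr0n mulr0 addr0.
  apply: (@le_trans _ _ (4 / c ^+ 2 * \sum_(l < L) turn y l * stm c dl l (pre y l) ^+ 2)).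
    rewrite mulr_sumr; apply: ler_sum => l _; rewrite mulrCA ler_wpM2l//.
    by apply: le_trans (pzf_le _ c0) _; rewrite mulrAC.
  have -> : 224 / c ^+ 2 = 4 / c ^+ 2 * 56 by field.
  by rewrite ler_wpM2l ?sum_turn// divr_ge0// ltW.
have h := le_trans lower upper; move: h.
set A := c ^+ 2 / _; rewrite -lerBlDl mulrC.
have -> : L%:R * P = P * L%:R by rewrite mulrC.
rewrite -ler_pdivrMr// mulrBl mulfK ?gt_eqF// => h; apply: le_trans h.
by rewrite invfM mulrA.
Qed.

End amplification.
End tree.

(** * Functions of binary digits *)

Definition digits := nat -> bool.

Definition upd (w : digits) i b : digits := fun j => if j == i then b else w j.
Definition flip i (w : digits) := upd w i (~~ w i).

Lemma upd_id w i : upd w i (w i) = w.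
Proof. by apply/funext => j; rewrite /upd; case: eqP => // ->. Qed.

Lemma updK w i b b' : upd (upd w i b) i b' = upd w i b'.
Proof. by apply/funext => j; rewrite /upd; case: eqP. Qed.

Lemma updC w i j b b' : i != j -> upd (upd w i b) j b' = upd (upd w j b') i b.
Proof.
move=> ij; apply/funext => k; rewrite /upd; case: eqP => // ->.
by rewrite eq_sym (negbTE ij).
Qed.

Lemma flip_upd w i b : flip i (upd w i b) = upd w i (~~ b).
Proof. by rewrite /flip updK /upd eqxx. Qed.

Lemma flip_updC w i j b : i != j -> flip i (upd w j b) = upd (flip i w) j b.
Proof.
move=> ij; rewrite /flip; have -> : upd w j b i = w i by rewrite /upd (negbTE ij).
by rewrite -updC.
Qed.

Definition agree_off p q (w w' : digits) :=
  forall i, ~~ (p <= i < p + q)%N -> w i = w' i.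

Fixpoint chunk p q (w : digits) : nat :=
  if q is q'.+1 then ((chunk p q' w).*2 + w (p + q')%N)%N else 0%N.

Lemma eq_chunk p q w w' : (forall i, (p <= i < p + q)%N -> w i = w' i) ->
  chunk p q w = chunk p q w'.
Proof.
elim: q => [//|q IH] h /=; rewrite IH; last by move=> i hi; apply: h; lia.
by rewrite h//; lia.
Qed.

Lemma chunk_lt p q w : (chunk p q w < 2 ^ q)%N.
Proof. elim: q => [//|q IH] /=; rewrite expnS; case: (w _); lia. Qed.

Lemma chunk_half p q w : (chunk p q.+1 w)./2 = chunk p q w.
Proof. by rewrite /= addnC half_bit_double. Qed.

Lemma odd_chunk p q w : odd (chunk p q.+1 w) = w (p + q)%N.
Proof. by rewrite /= oddD odd_double addFb oddb. Qed.

Lemma chunk_divn p q m w : (chunk p (q + m) w %/ 2 ^ m)%N = chunk p q w.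
Proof.
elim: m => [|m IH]; first by rewrite addn0 divn1.
by rewrite expnS divnMA divn2 addnS chunk_half IH.
Qed.

Definition dep (X : Type) m (F : digits -> X) :=
  forall w w', (forall i, (i < m)%N -> w i = w' i) -> F w = F w'.

Section average.
Variable R : realFieldType.
Implicit Types (F G : digits -> R) (w : digits).

Definition rad i w : R := sg R (w i).

Lemma rad_sqr i w : rad i w ^+ 2 = 1. Proof. exact: sg_sqr. Qed.

Lemma rad_norm i w : `|rad i w| = 1.
Proof. by rewrite /rad /sg normrX normrN1 expr1n. Qed.

Lemma rad_upd i w b : rad i (upd w i b) = sg R b.
Proof. by rewrite /rad /upd eqxx. Qed.

Definition avg i F w : R := (F (upd w i false) + F (upd w i true)) / 2.

(** Conditional expectation of [F] given the digits outside [[p, p + q)], kept as a function of the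
    whole digit sequence so that windows can be nested. *)
Fixpoint avgs p q F : digits -> R :=
  if q is q'.+1 then avgs p q' (avg (p + q')%N F) else F.

Lemma avgs_cat p q q' F : avgs p (q + q')%N F = avgs p q (avgs (p + q)%N q' F).
Proof.
elim: q' F => [|q' IH] F; first by rewrite addn0.
by rewrite addnS /= IH addnA.
Qed.

Lemma avgsD p q F G w : avgs p q (fun w => F w + G w) w = avgs p q F w + avgs p q G w.
Proof.
elim: q F G => [//|q IH] F G /=; rewrite -IH.
by congr (avgs p q _ w); apply/funext => v; rewrite /avg; field.
Qed.

Lemma avgsZ p q a F w : avgs p q (fun w => a * F w) w = a * avgs p q F w.
Proof.
elim: q F => [//|q IH] F /=; rewrite -IH.
by congr (avgs p q _ w); apply/funext => v; rewrite /avg; field.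
Qed.

Lemma avgs_cst p q a w : avgs p q (fun=> a) w = a.
Proof.
elim: q => [//|q IH] /=; rewrite -[RHS]IH.
by congr (avgs p q _ w); apply/funext => v; rewrite /avg; field.
Qed.

Lemma ler_avgs p q F G w :
  (forall v, agree_off p q v w -> F v <= G v) -> avgs p q F w <= avgs p q G w.
Proof.
elim: q F G => [|q IH] F G FG /=; first exact: FG.
apply: IH => v vw; rewrite ler_pM2r ?invr_gt0 ?ltr0n//.
by apply: lerD; apply: FG => i hi; rewrite /upd ifN ?vw//; try lia; apply/eqP; lia.
Qed.

Lemma eq_avgs p q F G w :
  (forall v, agree_off p q v w -> F v = G v) -> avgs p q F w = avgs p q G w.
Proof. by move=> FG; apply/eqP; rewrite eq_le !ler_avgs// => v /FG ->. Qed.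

Lemma avgs_chunk p q (F : nat -> R) w :
  avgs p q (fun w => F (chunk p q w)) w = tavg q F.
Proof.
elim: q F => [//|q IH] F /=; rewrite -IH; congr (avgs p q _ w).
apply/funext => v; rewrite /avg /= /upd eqxx addn0 addn1.
by rewrite !(@eq_chunk p q _ v)// => i hi; rewrite ifN//; apply/eqP; lia.
Qed.

Section rademacher.
Variables (p : nat) (x : R) (d : nat -> R).
Let Z L w := x + \sum_(l < L) d l * rad (p + l)%N w.
Let s L := x ^+ 2 + \sum_(l < L) d l ^+ 2.

Let Z_upd L w b : Z L.+1 (upd w (p + L)%N b) = Z L w + d L * sg R b.
Proof.
rewrite /Z big_ord_recr /= addrA rad_upd; congr (_ + _ + _).
apply: eq_bigr => i _; rewrite /rad /upd ifN//; apply/eqP; have := ltn_ord i; lia.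
Qed.

Lemma avgs_rad2 L w : avgs p L (fun w => Z L w ^+ 2) w = s L.
Proof.
elim: L => [|L IH]; first by rewrite /= /Z /s !big_ord0 !addr0.
rewrite /s big_ord_recr /= addrA -/(s L) -IH -[X in _ + X](avgs_cst p L _ w) -avgsD.
congr (avgs p L _ w); apply/funext => v; rewrite /avg !Z_upd /sg expr0 expr1; by field.
Qed.

Lemma avgs_rad4 L w : avgs p L (fun w => Z L w ^+ 4) w <= 3 * s L ^+ 2.
Proof.
elim: L => [|L IH].
  rewrite /= /Z /s !big_ord0 !addr0 -exprM ler_peMl ?exprn_even_ge0//; lra.
have -> : s L.+1 = s L + d L ^+ 2 by rewrite /s big_ord_recr /= addrA.
have -> : avgs p L.+1 (fun w => Z L.+1 w ^+ 4) w =
    avgs p L (fun w => Z L w ^+ 4) w + 6 * d L ^+ 2 * s L + d L ^+ 4.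
  rewrite -[in RHS](avgs_rad2 L w) -avgsZ -[X in _ + X](avgs_cst p L _ w) -!avgsD /=.
  congr (avgs p L _ w); apply/funext => v; rewrite /avg !Z_upd /sg expr0 expr1; by field.
have := exprn_even_ge0 (d L) (isT : ~~ odd 4).
have -> : d L ^+ 4 = (d L ^+ 2) ^+ 2 by rewrite -exprM.
move: IH; set A := avgs _ _ _ _; move: (s L) (d L ^+ 2) => y z; nra.
Qed.

(** Paley-Zygmund for [Z ^ 2], whose mean is [s >= 2] and whose second moment is at most
    [3 * s ^ 2]: the probability is at least [(s - 1) ^ 2 / (3 * s ^ 2) >= 1 / 12], whatever the
    constant term [x]. The indicator is again bounded below by a quadratic [2 * g - g ^ 2]. *)
Lemma avgs_rad_gt1 L w : 2 <= \sum_(l < L) d l ^+ 2 ->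
  12^-1 <= avgs p L (fun w => (1 < `|Z L w|)%R%:R) w.
Proof.
move=> h2; have h3 := avgs_rad2 L w; have h4 := avgs_rad4 L w.
have h5 : 2 <= s L by rewrite (le_trans h2)// lerDr sqr_ge0.
pose k := (s L - 1) / (3 * s L ^+ 2).
have s0 : 0 < s L by lra.
have k0 : 0 <= k by rewrite divr_ge0//; nra.
have h v : (2 * k + 2 * k ^+ 2) * Z L v ^+ 2 + (- k ^+ 2) * Z L v ^+ 4 + (- (2 * k + k ^+ 2)) <=
    (1 < `|Z L v|)%R%:R.
  have -> : Z L v ^+ 4 = (Z L v ^+ 2) ^+ 2 by rewrite -exprM.
  have : (1 < `|Z L v|) = (1 < Z L v ^+ 2).
    by rewrite -[in RHS]real_normK ?num_real// expr_gt1.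
  move=> ->; move: (Z L v ^+ 2) => y; set g := k * (y - 1).
  have -> : (2 * k + 2 * k ^+ 2) * y + - k ^+ 2 * y ^+ 2 + - (2 * k + k ^+ 2) = 2 * g - g ^+ 2.
    by rewrite /g; ring.
  case: ltP => hy; rewrite ?mulr1n ?mulr0n.
    have := sqr_ge0 (1 - g); nra.
  have : g <= 0 by rewrite /g mulr_ge0_le0// subr_le0.
  have := sqr_ge0 g; lra.
apply: (@le_trans _ _ (avgs p L (fun v => (2 * k + 2 * k ^+ 2) * Z L v ^+ 2 +
    (- k ^+ 2) * Z L v ^+ 4 + (- (2 * k + k ^+ 2))) w)); last exact: ler_avgs.
rewrite 2!avgsD !avgsZ avgs_cst h3.
have hk : k * (3 * s L ^+ 2) = s L - 1 by rewrite /k divfK//; apply: lt0r_neq0; nra.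
have h6 : k ^+ 2 * avgs p L (fun w => Z L w ^+ 4) w <= k * (s L - 1).
  by rewrite -hk mulrA -expr2 ler_wpM2l ?sqr_ge0.
have h7 : 12^-1 <= k * (s L - 1).
  rewrite /k mulrAC ler_pdivlMr; nra.
have h8 : 0 <= k ^+ 2 * (s L - 1) by rewrite mulr_ge0 ?sqr_ge0//; lra.
nra.
Qed.

End rademacher.

(** For [F] with [dep m F] the base point after the first [m] digits does not affect the value. *)
Definition expct m F : R := avgs 0 m F (fun=> false).

Lemma avgs_dep m q F w : dep m F -> avgs m q F w = F w.
Proof.
move=> h; rewrite (@eq_avgs m q F (fun=> F w) w) ?avgs_cst// => v vw.
by apply: h => i im; apply: vw; lia.
Qed.

Lemma expct_dep m q F : dep m F -> expct (m + q)%N F = expct m F.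
Proof.
by move=> h; rewrite /expct avgs_cat; congr (avgs 0 m _ _); apply/funext => w; exact: avgs_dep.
Qed.

Lemma avgs_mull m q F G w : dep m F -> avgs m q (fun w => F w * G w) w = F w * avgs m q G w.
Proof.
move=> h; rewrite -avgsZ; apply: eq_avgs => v vw; congr (_ * _).
by apply: h => i im; apply: vw; lia.
Qed.

Lemma avgs_flip i p q F : ~~ (p <= i < p + q)%N -> (forall w, F (flip i w) = - F w) ->
  forall w, avgs p q F (flip i w) = - avgs p q F w.
Proof.
elim: q F => [|q IH] F hi hF w //=; apply: IH => [|v]; first by lia.
have ij : i != (p + q)%N by apply/eqP; lia.
by rewrite /avg -!flip_updC// !hF; field.
Qed.

Lemma expct_odd i m F : (i < m)%N -> (forall w, F (flip i w) = - F w) -> expct m F = 0.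
Proof.
move=> im hF; have -> : (m = i + (m - i.+1).+1)%N by lia.
rewrite /expct avgs_cat -add1n avgs_cat add0n /= addn0.
rewrite -[RHS](avgs_cst 0 i 0 (fun=> false)); congr (avgs _ _ _ _).
apply/funext => w; rewrite /avg -[in X in _ + X](negbK true) -flip_upd avgs_flip//.
  by rewrite /= subrr mul0r.
by lia.
Qed.

Definition bit n i := odd (n %/ 2 ^ i).

(** Walsh functions in Paley order. As [n < 2 ^ n], no binary digit of [n] has index [n] or more, so
    the product is complete. *)
Definition walsh n w : R := \prod_(i < n) (if bit n i then rad i w else 1).

Lemma bit_ge n i : (n < 2 ^ i)%N -> bit n i = false.
Proof. by move=> h; rewrite /bit divn_small. Qed.

Lemma walshE m n w : (n < 2 ^ m)%N -> walsh n w = \prod_(i < m) (if bit n i then rad i w else 1).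
Proof.
have H k l : (n < 2 ^ k)%N -> (k <= l)%N ->
    \prod_(i < l) (if bit n i then rad i w else 1) = \prod_(i < k) (if bit n i then rad i w else 1).
  move=> nk kl; rewrite -!(big_mkord xpredT (fun i => if bit n i then rad i w else 1)).
  rewrite (big_cat_nat (n := k))//= [X in _ * X]big_nat_cond [X in _ * X]big1 ?mulr1//.
  move=> i hi; rewrite bit_ge// (leq_trans nk)// leq_exp2l//; lia.
move=> nm; have nn : (n < 2 ^ n)%N by exact: ltn_expl.
rewrite /walsh; have [h|h] := leqP n m; first by rewrite (H n m).
by rewrite (H m n)// ltnW.
Qed.

Lemma walsh0 w : walsh 0 w = 1. Proof. by rewrite /walsh big_ord0. Qed.

Lemma walsh_norm n w : `|walsh n w| = 1.
Proof.
rewrite /walsh normr_prod big1// => i _; case: ifP => _; by rewrite ?normr1 ?rad_norm.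
Qed.

Lemma walsh_sqr n w : walsh n w ^+ 2 = 1.
Proof. by rewrite -real_normK ?num_real// walsh_norm expr1n. Qed.

Lemma walsh_dep m n : (n < 2 ^ m)%N -> dep m (walsh n).
Proof.
move=> nm w w' ww; rewrite !(walshE _ nm); apply: eq_bigr => i _.
by rewrite /rad ww.
Qed.

Lemma walshD n q w : (n < 2 ^ q)%N -> walsh (n + 2 ^ q)%N w = walsh n w * rad q w.
Proof.
move=> nq; have nq1 : (n + 2 ^ q < 2 ^ q.+1)%N by rewrite expnS; lia.
rewrite (walshE _ nq1) (walshE _ nq) big_ord_recr /=; congr (_ * _).
  apply: eq_bigr => i _; rewrite /bit; case: i => i /= iq.
  have -> : (2 ^ q = 2 ^ (q - i).-1.+1 * 2 ^ i)%N by rewrite -expnD; congr (2 ^ _)%N; lia.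
  by rewrite addnC divnMDl ?expn_gt0// oddD expnS mul2n odd_double.
rewrite /bit divnDr ?dvdnn// divnn expn_gt0 /= divn_small//.
Qed.

Lemma walsh_flip n i w : walsh n (flip i w) = sg R (bit n i) * walsh n w.
Proof.
have h : (n < 2 ^ (n + i.+1))%N.
  by apply: leq_trans (ltn_expl n (ltnSn 1)) _; rewrite leq_exp2l//; lia.
have ii : (i < n + i.+1)%N by lia.
rewrite !(walshE _ h) (bigD1 (Ordinal ii))//= [in RHS](bigD1 (Ordinal ii))//= mulrA; congr (_ * _).
  rewrite /rad /flip /upd eqxx; case: (bit n i); rewrite ?mulr1//=.
  by rewrite /sg -signr_addb addTb.
apply: eq_bigr => j; rewrite -val_eqE /= => ji; by rewrite /rad /flip /upd (negbTE ji).
Qed.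

Lemma bit_inj M m n : (m < 2 ^ M)%N -> (n < 2 ^ M)%N ->
  (forall i, (i < M)%N -> bit m i = bit n i) -> m = n.
Proof.
elim: M m n => [|M IH] m n; first by rewrite expn0; lia.
rewrite expnS => hm hn h; rewrite -(odd_double_half m) -(odd_double_half n).
have := h 0%N isT; rewrite /bit !divn1 => ->; congr (_ + _.*2)%N; apply: IH; try lia.
by move=> i iM; have := h i.+1 iM; rewrite /bit expnS !divnMA !divn2.
Qed.

Lemma expct_walsh M m n : (m < 2 ^ M)%N -> (n < 2 ^ M)%N ->
  expct M (fun w => walsh m w * walsh n w) = (m == n)%:R.
Proof.
move=> hm hn; have [->|mn] := eqVneq m n.
  rewrite -[RHS](avgs_cst 0 M _ (fun=> false)); congr (avgs _ _ _ _).
  by apply/funext => w; rewrite -expr2 walsh_sqr.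
have [i iM hi] : exists2 i, (i < M)%N & bit m i != bit n i.
  apply: contrapT => H; move/eqP: mn; apply; apply: (bit_inj hm hn) => i iM.
  by apply/eqP/negPn/negP => e; apply: H; exists i.
apply: (expct_odd iM) => w; rewrite !walsh_flip mulrACA /sg -signr_addb.
by rewrite -negb_eqb hi expr1 mulN1r.
Qed.

End average.

(** * Means and frequencies of Walsh polynomials *)

Section spectrum.
Variable R : realFieldType.
Implicit Types (f g : digits -> R) (A B : nat -> Prop).

Definition mean f (e : R) := exists m, dep m f /\ expct m f = e.

(** With one coefficient equal to 0 this also serves for scalar multiples, hence the dummy summands
    [0 * _] in later proofs. *)
Lemma mean_lin a b f g x y : mean f x -> mean g y ->
  mean (fun w => a * f w + b * g w) (a * x + b * y).
Proof.
move=> [m [dm <-]] [n [dn <-]]; exists (m + n)%N; split.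
  move=> w w' ww; rewrite (dm w w') ?(dn w w')// => i hi; apply: ww; lia.
rewrite /expct avgsD !avgsZ -!/(expct _ _) expct_dep//.
by rewrite addnC expct_dep.
Qed.

Lemma mean0 : mean (fun=> 0) 0.
Proof. by exists 0%N; split. Qed.

Lemma mean_sum n (f : nat -> digits -> R) (x : nat -> R) :
  (forall i, (i < n)%N -> mean (f i) (x i)) ->
  mean (fun w => \sum_(i < n) f i w) (\sum_(i < n) x i).
Proof.
elim: n => [|n IH] h.
  rewrite big_ord0; have -> : (fun w => \sum_(i < 0) f i w) = fun=> 0; last exact: mean0.
  by apply/funext => w; rewrite big_ord0.
have := mean_lin 1 1 (IH (fun i hi => h i (ltnW hi))) (h n (ltnSn n)).
rewrite !mul1r big_ord_recr /=; congr mean; apply/funext => w.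
by rewrite big_ord_recr /= !mul1r.
Qed.

Lemma mean_walsh m n : mean (fun w => walsh R m w * walsh R n w) (m == n)%:R.
Proof.
have hm : (m < 2 ^ (m + n))%N.
  by apply: leq_trans (ltn_expl m (ltnSn 1)) _; rewrite leq_exp2l//; lia.
have hn : (n < 2 ^ (m + n))%N.
  by apply: leq_trans (ltn_expl n (ltnSn 1)) _; rewrite leq_exp2l//; lia.
exists (m + n)%N; split; last exact: expct_walsh.
by move=> w w' ww; rewrite (walsh_dep R hm ww) (walsh_dep R hn ww).
Qed.

(* [f] is a Walsh polynomial with frequencies in [A]. *)
Definition spec A f := exists s : seq (R * nat), (forall x, x \in s -> A x.2) /\
  f = fun w => \sum_(x <- s) x.1 * walsh R x.2 w.

Lemma spec_walsh A n : A n -> spec A (walsh R n).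
Proof.
move=> An; exists [:: (1, n)]; split; first by move=> x; rewrite inE => /eqP ->.
by apply/funext => w; rewrite big_seq1 mul1r.
Qed.

Lemma spec0 A : spec A (fun=> 0).
Proof. by exists [::]; split=> //; apply/funext => w; rewrite big_nil. Qed.

Lemma spec_lin A a b f g : spec A f -> spec A g -> spec A (fun w => a * f w + b * g w).
Proof.
move=> [s [sA ->]] [t [tA ->]].
exists ([seq (a * x.1, x.2) | x <- s] ++ [seq (b * x.1, x.2) | x <- t]); split.
  by move=> x; rewrite mem_cat => /orP[]/mapP[y yi -> /=]; [exact: sA|exact: tA].
apply/funext => w; rewrite big_cat !big_map !mulr_sumr.
by congr (_ + _); apply: eq_bigr => x _; rewrite mulrA.
Qed.

Lemma spec_sum A n (f : nat -> digits -> R) :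
  (forall i, (i < n)%N -> spec A (f i)) -> spec A (fun w => \sum_(i < n) f i w).
Proof.
elim: n => [|n IH] h.
  have -> : (fun w => \sum_(i < 0) f i w) = fun=> 0; last exact: spec0.
  by apply/funext => w; rewrite big_ord0.
have := spec_lin 1 1 (IH (fun i hi => h i (ltnW hi))) (h n (ltnSn n)).
by congr spec; apply/funext => w; rewrite big_ord_recr /= !mul1r.
Qed.

Lemma spec_mono A B f : (forall n, A n -> B n) -> spec A f -> spec B f.
Proof. by move=> AB [s [sA ->]]; exists s; split=> // x /sA/AB. Qed.

Lemma spec_rad A B q f : (forall n, A n -> (n < 2 ^ q)%N /\ B (n + 2 ^ q)%N) ->
  spec A f -> spec B (fun w => f w * rad R q w).
Proof.
move=> AB [s [sA ->]]; exists [seq (x.1, (x.2 + 2 ^ q)%N) | x <- s]; split.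
  by move=> x /mapP[y /sA/AB[_ h] ->].
apply/funext => w; rewrite big_map mulr_suml big_seq [RHS]big_seq.
by apply: eq_bigr => x /sA/AB[h _]; rewrite /= walshD// mulrA.
Qed.

Lemma spec_orth A B f g : (forall n, A n -> B n -> False) ->
  spec A f -> spec B g -> mean (fun w => f w * g w) 0.
Proof.
move=> AB [s [sA ->]] [t [tB ->]].
elim: s sA => [|x s IH] sA.
  by congr mean: mean0; apply/funext => w; rewrite big_nil mul0r.
have H : mean (fun w => walsh R x.2 w * \sum_(y <- t) y.1 * walsh R y.2 w) 0.
  elim: t tB {IH} => [|y t IH] tB.
    by congr mean: mean0; apply/funext => w; rewrite big_nil mulr0.
  have /(mean_lin y.1 1 (mean_walsh x.2 y.2)) : mean (fun w =>
      walsh R x.2 w * \sum_(y <- t) y.1 * walsh R y.2 w) 0.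
    by apply: IH => z zt; apply: tB; rewrite inE zt orbT.
  case: eqP => [e| _].
    by exfalso; apply: (AB x.2); [apply: sA|rewrite e; apply: tB]; rewrite inE eqxx.
  rewrite !mulr0 addr0; congr mean; apply/funext => w; rewrite big_cons; ring.
have {}IH := IH (fun z zs => sA z (mem_behead (s := x :: s) zs)).
have := mean_lin x.1 1 H IH; rewrite !mulr0 addr0; congr mean.
by apply/funext => w; rewrite big_cons; ring.
Qed.

End spectrum.

(** * The Haar matrix and the blocks *)

Section haar.
Variable R : rcfType.

Definition wt l : R := Num.sqrt (2 ^+ l).

Lemma wt_ge0 l : 0 <= wt l. Proof. exact: sqrtr_ge0. Qed.

Lemma wt_gt0 l : 0 < wt l. Proof. by rewrite sqrtr_gt0 exprn_gt0. Qed.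

Lemma wt_sqr l : wt l ^+ 2 = 2 ^+ l.
Proof. by rewrite sqr_sqrtr// exprn_ge0. Qed.

Lemma wtS_ge l : 4 / 3 * wt l <= wt l.+1.
Proof.
rewrite -(ler_pXn2r (n := 2)) ?nnegrE ?wt_ge0//; last by rewrite mulr_ge0 ?wt_ge0//; lra.
rewrite exprMn !wt_sqr [2 ^+ l.+1]exprS ler_pM2r ?exprn_gt0//; lra.
Qed.

(** By [wtS_ge] consecutive weights grow at least by [4 / 3], a rational bound for the square root
    of 2, and 3 solves [C + 1 = 4 / 3 * C]. *)
Lemma sum_wt n : \sum_(l < n) wt l <= 3 * wt n.
Proof.
elim: n => [|n IH]; first by rewrite big_ord0 mulr_ge0 ?wt_ge0.
rewrite big_ord_recr /=; have := wtS_ge n; have := wt_ge0 n; lra.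
Qed.

(* Row [i] of the orthogonal [2 ^ M] by [2 ^ M] Haar matrix, scaled by
   [2 ^ (M / 2)] and applied to the vector of functions [x, h]. *)
Definition haar M (x : digits -> R) (h : nat -> nat -> digits -> R) i w : R :=
  x w + \sum_(l < M) wt l * sg R (odd (i %/ 2 ^ (M - l.+1))) * h l (i %/ 2 ^ (M - l))%N w.

Let shiftE M l j : (l < M)%N -> (j %/ 2 ^ (M.+1 - l) = j./2 %/ 2 ^ (M - l))%N.
Proof. by move=> lM; rewrite subSn ?(ltnW lM)// expnS divnMA divn2. Qed.

Let shiftE1 M l j : (l < M)%N -> (j %/ 2 ^ (M.+1 - l.+1) = j./2 %/ 2 ^ (M - l.+1))%N.
Proof.
move=> lM; have -> : (M.+1 - l.+1 = (M - l.+1).+1)%N by lia.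
by rewrite expnS divnMA divn2.
Qed.

Lemma haarS M x h i w : haar M.+1 x h i w =
  haar M x h i./2 w + wt M * sg R (odd i) * h M i./2 w.
Proof.
rewrite /haar big_ord_recr /= subnn divn1 subSnn expn1 divn2 addrA.
congr (_ + _ + _); apply: eq_bigr => -[l lM] _ /=.
by rewrite shiftE1// shiftE//.
Qed.

(** Halving [i] and [j] removes the last level. That level contributes only if the halves agree; it
    then doubles [2 ^ M] when [i = j] and cancels it for siblings. *)
Lemma haar_orth M i j : (i < 2 ^ M)%N -> (j < 2 ^ M)%N ->
  1 + \sum_(l < M) 2 ^+ l * (sg R (odd (i %/ 2 ^ (M - l.+1))) * sg R (odd (j %/ 2 ^ (M - l.+1)))) *
    ((i %/ 2 ^ (M - l) == j %/ 2 ^ (M - l))%N)%:R = 2 ^+ M * (i == j)%:R.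
Proof.
elim: M i j => [|M IH] i j hi hj.
  rewrite expn0 in hi hj; have -> : i == j by apply/eqP; lia.
  by rewrite big_ord0 addr0 expr0 mulr1n mulr1.
rewrite big_ord_recr /= addrA.
rewrite (eq_bigr (fun l : 'I_M => 2 ^+ l *
    (sg R (odd (i./2 %/ 2 ^ (M - l.+1))) * sg R (odd (j./2 %/ 2 ^ (M - l.+1)))) *
    ((i./2 %/ 2 ^ (M - l) == j./2 %/ 2 ^ (M - l))%N)%:R)); last first.
  by move=> [l lM] _ /=; rewrite 2?shiftE1// 2?shiftE.
rewrite expnS in hi hj; rewrite IH; [|lia..].
rewrite subnn !divn1 subSnn expn1 !divn2.
have -> : (i == j) = (odd i == odd j) && (i./2 == j./2).
  apply/eqP/andP => [->//|[/eqP h1 /eqP h2]].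
  by rewrite -(odd_double_half i) -(odd_double_half j) h1 h2.
case: (i./2 == j./2); rewrite ?andbT ?andbF ?mulr0n ?mulr1n ?mulr0 ?addr0//.
by rewrite exprS /sg; case: (odd i); case: (odd j); rewrite /= ?mulr0n ?mulr1n; ring.
Qed.

(** The rotation is inverted one level at a time: sibling rows have as half-sum the row above and as
    half-difference a multiple of [h M]. Any class closed under linear combinations may serve as
    [P]. *)
Lemma haar_span (P : (digits -> R) -> Prop) M x h :
  (forall a b f g, P f -> P g -> P (fun w => a * f w + b * g w)) ->
  (forall i, (i < 2 ^ M)%N -> P (haar M x h i)) ->
  P x /\ forall l v, (l < M)%N -> (v < 2 ^ l)%N -> P (h l v).
Proof.
move=> Plin; elim: M => [|M IH] hP.
  split=> //; have := hP 0%N isT; congr P; apply/funext => w.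
  by rewrite /haar big_ord0 addr0.
have P0 v : (v < 2 ^ M)%N -> P (haar M.+1 x h v.*2) /\ P (haar M.+1 x h v.*2.+1).
  by move=> hv; split; apply: hP; rewrite expnS; lia.
have [|Px Ph] := IH.
  move=> v /P0[h1 h2]; have := Plin 2^-1 2^-1 _ _ h1 h2; congr P; apply/funext => w.
  rewrite !haarS doubleK odd_double /= uphalf_double odd_double /sg /=; by field.
split=> // l v; rewrite ltnS leq_eqVlt => /orP[/eqP ->|]; last exact: Ph.
move=> /P0[h1 h2]; have := Plin (2 * wt M)^-1 (- (2 * wt M)^-1) _ _ h1 h2.
congr P; apply/funext => w.
rewrite !haarS doubleK odd_double /= uphalf_double odd_double /sg /=; field.
by rewrite gt_eqF ?wt_gt0.
Qed.

End haar.

Section block.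
Variable R : rcfType.
Variables (p L c : nat).

(* In the block, the [L] digits read by [chunk] choose a cell at every level, and
   the last [L] digits carry one independent sign per level. Since at each point
   only one cell per level is active and the levels [l >= L] have weights
   [2 ^ (l / 2)], the Haar rotation of size [4 ^ L] of these functions, divided
   by [2 ^ L], is uniformly bounded. *)
Definition hb l v w : R :=
  if (l < L)%N then wt R l * (chunk (p + 2 * L) l w == v)%:R * rad R (p + 3 * L + l)%N w
  else walsh R ((2 ^ l + v) * 2 ^ p)%N w.

Definition thf i w : R := (2 ^+ L)^-1 * haar (2 * L)%N (walsh R c) hb i w.

(* The Walsh frequencies of the functions [hb l v]. *)
Definition ucode l n : Prop :=
  if (l < L)%N then exists2 s, (s < 2 ^ l)%N & n = (s * 2 ^ (p + 2 * L) + 2 ^ (p + 3 * L + l))%N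
  else exists2 v, (v < 2 ^ l)%N & n = ((2 ^ l + v) * 2 ^ p)%N.

Definition ulog l := if (l < L)%N then (p + 3 * L + l)%N else (p + l)%N.

Lemma ucode_small s l : (l < L)%N -> (s < 2 ^ l)%N ->
  (s * 2 ^ (p + 2 * L) < 2 ^ (p + 3 * L + l))%N.
Proof.
move=> lL sl; apply: (@leq_trans (2 ^ l * 2 ^ (p + 2 * L))).
  by rewrite ltn_mul2r expn_gt0.
by rewrite -expnD leq_exp2l//; lia.
Qed.

(** All frequencies of one level share their leading binary digit. As [ulog] is injective, distinct
    levels have disjoint spectra and are orthogonal. *)
Lemma ucode_log l n : ucode l n -> trunc_log 2 n = ulog l.
Proof.
rewrite /ucode /ulog; case: ltnP => lL [s sl ->]; apply: trunc_log_eq => //.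
  by have := ucode_small lL sl; rewrite expnS; lia.
rewrite addnC expnS expnD mulnA leq_mul2r leq_addr orbT ltn_mul2r expn_gt0 /=; lia.
Qed.

Lemma ulog_inj l l' : (l < 2 * L)%N -> (l' < 2 * L)%N -> ulog l = ulog l' -> l = l'.
Proof. by rewrite /ulog; case: (ltnP l L) => ?; case: (ltnP l' L) => ?; lia. Qed.

Lemma ucode_lt l n : (l < 2 * L)%N -> ucode l n -> (2 ^ p <= n < 2 ^ (p + 4 * L))%N.
Proof.
move=> lL /[dup] /ucode_log e u; have n0 : (0 < n)%N.
  by move: u; rewrite /ucode; case: ifP => _ [s _ ->];
      rewrite ?muln_gt0 addn_gt0 !expn_gt0 ?orbT.
have := trunc_logP (ltnSn 1) n0; have := trunc_log_ltn n (ltnSn 1); rewrite e => h1 h2.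
by apply/andP; split; [apply: leq_trans h2|apply: leq_trans h1 _];
  rewrite leq_exp2l// /ulog; case: (ltnP l L); lia.
Qed.

Lemma ucode_even l n : (0 < p)%N -> ucode l n -> ~~ odd n.
Proof.
move=> p0; rewrite /ucode; case: ifP => _ [s _ ->]; rewrite ?oddD !oddM !oddX; lia.
Qed.

Lemma chunk_eqS q l v (w : digits) : ((chunk q l.+1 w == v)%:R : R) =
  (chunk q l w == v./2)%:R * (2^-1 + sg R (odd v) / 2 * rad R (q + l)%N w).
Proof.
have -> : (chunk q l.+1 w == v) = (w (q + l)%N == odd v) && (chunk q l w == v./2).
  rewrite -(odd_chunk q l w) -(chunk_half q l w).
  apply/eqP/andP => [->//|[/eqP h1 /eqP h2]].
  by rewrite -(odd_double_half (chunk _ _ _)) h1 h2 odd_double_half.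
rewrite /rad /sg; case: (_ == _./2); last by rewrite andbF mul0r.
by rewrite andbT mul1r; case: (w _); case: (odd v) => /=; rewrite ?mulr1n ?mulr0n; field.
Qed.

Lemma spec_chunk q l v :
  spec (fun n => exists2 s, (s < 2 ^ l)%N & n = (s * 2 ^ q)%N)
    (fun w => (chunk q l w == v)%:R : R).
Proof.
elim: l v => [|l IH] v.
  pose A n := exists2 s, (s < 2 ^ 0)%N & n = (s * 2 ^ q)%N.
  have h : A 0%N by exists 0%N; rewrite ?mul0n.
  have := spec_lin ((0%N == v)%:R) 0 (@spec_walsh R A _ h) (@spec_walsh R A _ h).
  by congr spec; apply/funext => w; rewrite walsh0 mul0r addr0 mulr1.
have h1 := IH v./2.
have h2 : spec (fun n => exists2 s, (s < 2 ^ l.+1)%N & n = (s * 2 ^ q)%N)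
    (fun w => (chunk q l w == v./2)%:R * rad R (q + l)%N w).
  apply: spec_rad h1 => _ [s sl ->]; split.
    by rewrite addnC expnD ltn_mul2r expn_gt0.
  exists (s + 2 ^ l)%N; first by rewrite expnS; lia.
  by rewrite mulnDl -expnD (addnC q).
have {}h1 : spec (fun n => exists2 s, (s < 2 ^ l.+1)%N & n = (s * 2 ^ q)%N)
    (fun w => (chunk q l w == v./2)%:R : R).
  by apply: spec_mono h1 => _ [s sl ->]; exists s => //; rewrite expnS; lia.
have := spec_lin 2^-1 (sg R (odd v) / 2) h1 h2.
by congr spec; apply/funext => w; rewrite chunk_eqS; ring.
Qed.

Lemma spec_hb l v : (v < 2 ^ l)%N -> spec (ucode l) (hb l v).
Proof.
move=> vl; rewrite /ucode /hb; case: ltnP => lL; last first.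
  by apply: (@spec_walsh R (fun n => exists2 v, _ & _)); exists v.
have H : spec (fun n => exists2 s, (s < 2 ^ l)%N &
    n = (s * 2 ^ (p + 2 * L) + 2 ^ (p + 3 * L + l))%N)
   (fun w => (chunk (p + 2 * L) l w == v)%:R * rad R (p + 3 * L + l)%N w).
  apply: spec_rad (spec_chunk _ _ _) => _ [s sl ->]; split; first exact: ucode_small.
  by exists s.
have := spec_lin (wt R l) 0 H H; congr spec.
by apply/funext => w; rewrite mul0r addr0 mulrA.
Qed.

Lemma tavg_delta l v : (v < 2 ^ l)%N -> tavg l (fun u => (u == v)%:R) = (2 ^+ l)^-1 :> R.
Proof.
elim: l v => [|l IH] v.
  by rewrite expn0 => /=; case: v => // _; rewrite invr1.
rewrite expnS => hv /=.
transitivity (tavg l (fun u => 2^-1 * (u == v./2)%:R : R)); last first.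
  by rewrite tavgZ IH ?exprS ?invfM//; lia.
apply: eq_tavg => u.
have -> : (u.*2 == v) = ~~ odd v && (u == v./2) by apply/eqP/andP => [<-|[? /eqP->]]; lia.
have -> : (u.*2.+1 == v) = odd v && (u == v./2) by apply/eqP/andP => [<-|[? /eqP->]]; lia.
by case: (odd v); case: (u == _) => /=; rewrite ?mulr1n ?mulr0n; field.
Qed.

Lemma mean_hb l v v' : (v < 2 ^ l)%N -> (v' < 2 ^ l)%N ->
  mean (fun w => hb l v w * hb l v' w) (v == v')%:R.
Proof.
move=> hv hv'; rewrite /hb; case: ltnP => lL; last first.
  have := mean_walsh R ((2 ^ l + v) * 2 ^ p)%N ((2 ^ l + v') * 2 ^ p)%N.
  by rewrite eqn_pmul2r ?expn_gt0// eqn_add2l.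
have -> : (fun w => wt R l * (chunk (p + 2 * L) l w == v)%:R * rad R (p + 3 * L + l)%N w *
    (wt R l * (chunk (p + 2 * L) l w == v')%:R * rad R (p + 3 * L + l)%N w)) =
  fun w => 2 ^+ l * ((v == v')%:R * (chunk (p + 2 * L) l w == v)%:R).
  apply/funext => w; rewrite -(wt_sqr R l).
  transitivity (wt R l ^+ 2 * rad R (p + 3 * L + l)%N w ^+ 2 *
    ((chunk (p + 2 * L) l w == v)%:R * (chunk (p + 2 * L) l w == v')%:R)); first by ring.
  rewrite rad_sqr mulr1; congr (_ * _); case: eqP => [->|]; last by rewrite mulr0 mul0r.
  by rewrite mul1r mulr1.
exists (p + 2 * L + l)%N; split.
  move=> w w' ww; congr (_ * (_ * (_ == _)%:R)); apply: eq_chunk => i hi; apply: ww; lia.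
rewrite /expct avgs_cat add0n.
rewrite -[RHS](avgs_cst 0 (p + 2 * L) _ (fun=> false)); congr (avgs _ _ _ _).
apply/funext => w; rewrite 2!avgsZ (avgs_chunk _ _ (fun u => (u == v)%:R)) tavg_delta//.
by rewrite mulrCA mulfV ?mulr1// expf_neq0 ?pnatr_eq0.
Qed.

Definition tcode n : Prop := n = c \/ exists2 l, (l < 2 * L)%N & ucode l n.

Let cell_lt i l : (i < 2 ^ (2 * L))%N -> (l < 2 * L)%N -> (i %/ 2 ^ (2 * L - l) < 2 ^ l)%N.
Proof. by move=> h lL; rewrite ltn_divLR ?expn_gt0// -expnD subnKC// ltnW. Qed.

Lemma spec_thf i : (i < 2 ^ (2 * L))%N -> spec tcode (thf i).
Proof.
move=> iL; have h1 : spec tcode (walsh R c) by apply: (@spec_walsh R tcode); left.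
have h2 : spec tcode (fun w => \sum_(l < 2 * L) wt R l *
    sg R (odd (i %/ 2 ^ (2 * L - l.+1))) * hb l (i %/ 2 ^ (2 * L - l))%N w).
  apply: (@spec_sum _ _ _ (fun l w => wt R l *
    sg R (odd (i %/ 2 ^ (2 * L - l.+1))) * hb l (i %/ 2 ^ (2 * L - l))%N w)) => l lL.
  have h : spec tcode (hb l (i %/ 2 ^ (2 * L - l))%N).
    by apply: spec_mono (spec_hb (cell_lt iL lL)) => n ?; right; exists l.
  have := spec_lin (wt R l * sg R (odd (i %/ 2 ^ (2 * L - l.+1)))) 0 h h.
  by congr spec; apply/funext => w; rewrite mul0r addr0.
have := spec_lin (2 ^+ L)^-1 (2 ^+ L)^-1 h1 h2.
by congr spec; apply/funext => w; rewrite -mulrDr.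
Qed.

(** The functions fed into the rotation are orthonormal: [walsh c] is odd against even frequencies,
    levels are separated by leading digits and cells by [mean_hb]. What remains is the row product
    computed in [haar_orth]. *)
Lemma mean_thf i j : (0 < p)%N -> odd c -> (i < 2 ^ (2 * L))%N -> (j < 2 ^ (2 * L))%N ->
  mean (fun w => thf i w * thf j w) (i == j)%:R.
Proof.
move=> p0 c_odd iL jL.
pose a k l : R := wt R l * sg R (odd (k %/ 2 ^ (2 * L - l.+1))).
pose h k l := hb l (k %/ 2 ^ (2 * L - l))%N.
have sh k l : (k < 2 ^ (2 * L))%N -> (l < 2 * L)%N -> spec (ucode l) (h k l).
  by move=> kL lL; apply: spec_hb; exact: cell_lt.
have m1 k : (k < 2 ^ (2 * L))%N ->
    mean (fun w => \sum_(l < 2 * L) (a k l * (walsh R c w * h k l w) +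
      0 * (walsh R c w * h k l w))) 0.
  move=> kL; have : mean (fun w => \sum_(l < 2 * L) (a k l * (walsh R c w * h k l w) +
      0 * (walsh R c w * h k l w))) (\sum_(l < 2 * L) (a k l * 0 + 0 * 0)).
    apply: (@mean_sum _ _ (fun l w => a k l * (walsh R c w * h k l w) +
      0 * (walsh R c w * h k l w)) (fun l => a k l * 0 + 0 * 0)) => l lL.
    have H : mean (fun w => walsh R c w * h k l w) 0.
      apply: (spec_orth (A := eq c) _ (@spec_walsh R (eq c) c erefl) (sh k l kL lL)).
      move=> n <- /ucode_even.
      by rewrite c_odd => /(_ p0).
    exact: mean_lin.
  by rewrite big1// => l _; rewrite !mulr0 addr0.
have m2 : mean (fun w => \sum_(l < 2 * L) \sum_(l' < 2 * L)
     (a i l * a j l' * (h i l w * h j l' w) + 0 * (h i l w * h j l' w)))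
   (\sum_(l < 2 * L) \sum_(l' < 2 * L) (a i l * a j l' *
      ((l == l') && (i %/ 2 ^ (2 * L - l) == j %/ 2 ^ (2 * L - l')))%N%:R)).
  apply: (@mean_sum _ _ (fun l w => \sum_(l' < 2 * L)
     (a i l * a j l' * (h i l w * h j l' w) + 0 * (h i l w * h j l' w)))
    (fun l => \sum_(l' < 2 * L) (a i l * a j l' *
      ((l == l') && (i %/ 2 ^ (2 * L - l) == j %/ 2 ^ (2 * L - l')))%N%:R))) => l lL.
  apply: (@mean_sum _ _ (fun l' w => 
     (a i l * a j l' * (h i l w * h j l' w) + 0 * (h i l w * h j l' w)))
    (fun l' => (a i l * a j l' *
      ((l == l') && (i %/ 2 ^ (2 * L - l) == j %/ 2 ^ (2 * L - l')))%N%:R))) => l' l'L.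
  have [<-|ll] := eqVneq l l'.
    have H := mean_hb (cell_lt iL lL) (cell_lt jL lL).
    by have := mean_lin (a i l * a j l) 0 H H; rewrite mul0r addr0 andTb.
  have H : mean (fun w => h i l w * h j l' w) 0.
    apply: (spec_orth _ (sh i l iL lL) (sh j l' jL l'L)) => n /ucode_log h1 /ucode_log h2.
    by move/eqP: ll; apply; apply: ulog_inj => //; rewrite -h1 -h2.
  by have := mean_lin (a i l * a j l') 0 H H; rewrite mul0r addr0.
have m3 := mean_lin 1 1 (mean_lin 1 1 (mean_lin 1 1 (mean_walsh R c c) (m1 i iL)) (m1 j jL)) m2.
have := mean_lin ((2 ^+ L)^-1 ^+ 2) 0 m3 m3.
rewrite mul0r addr0; congr mean.
  apply/funext => w; rewrite mul0r addr0 !mul1r /thf /haar.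
  have -> : \sum_(l < 2 * L) \sum_(l' < 2 * L)
      (a i l * a j l' * (h i l w * h j l' w) + 0 * (h i l w * h j l' w)) =
    (\sum_(l < 2 * L) a i l * h i l w) * (\sum_(l < 2 * L) a j l * h j l w).
    rewrite mulr_suml; apply: eq_bigr => l _; rewrite mulr_sumr; apply: eq_bigr => l' _; ring.
  have E k : \sum_(l < 2 * L) (a k l * (walsh R c w * h k l w) + 0 * (walsh R c w * h k l w)) =
      walsh R c w * \sum_(l < 2 * L) a k l * h k l w.
    rewrite mulr_sumr; apply: eq_bigr => l _; ring.
  rewrite !E /a /h; ring.
rewrite eqxx mulr1n !mulr0 !addr0 !mul1r.
have -> : \sum_(l < 2 * L) \sum_(l' < 2 * L) (a i l * a j l' *
      ((l == l' :> nat) && (i %/ 2 ^ (2 * L - l) == j %/ 2 ^ (2 * L - l')))%N%:R) =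
  \sum_(l < 2 * L) 2 ^+ l * (sg R (odd (i %/ 2 ^ (2 * L - l.+1))) *
     sg R (odd (j %/ 2 ^ (2 * L - l.+1)))) *
    ((i %/ 2 ^ (2 * L - l) == j %/ 2 ^ (2 * L - l))%N)%:R.
  apply: eq_bigr => l _; rewrite (bigD1 l)//= big1 ?addr0 => [|l']; last first.
    by rewrite eq_sym -val_eqE /= => /negbTE ->; rewrite mulr0.
  rewrite eqxx /= -(wt_sqr R l) /a; ring.
by rewrite haar_orth// mulrA -exprVn -exprM mulnC exprVn mulVf ?mul1r ?expf_neq0 ?pnatr_eq0.
Qed.

(** Before division by [2 ^ L], the root gives 1, the active cells of the levels below [L] at most
    [2 ^ L - 1], and all weights together at most [3 * 2 ^ L]. *)
Lemma thf_bound i w : `|thf i w| <= 5.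
Proof.
rewrite /thf normrM normfV normrX gtr0_norm// ler_pdivrMl ?exprn_gt0//.
rewrite /haar; apply: le_trans (ler_normD _ _) _; rewrite walsh_norm.
have : `|\sum_(l < 2 * L) wt R l * sg R (odd (i %/ 2 ^ (2 * L - l.+1))) *
    hb l (i %/ 2 ^ (2 * L - l))%N w| <= \sum_(l < L) 2 ^+ l + \sum_(l < 2 * L) wt R l.
  apply: le_trans (ler_norm_sum _ _ _) _.
  pose g l : R := if (l < L)%N then 2 ^+ l else 0.
  apply: (@le_trans _ _ (\sum_(l < 2 * L) (g l + wt R l))).
    apply: ler_sum => -[l lL] _ /=; rewrite !normrM (ger0_norm (wt_ge0 R l)).
    rewrite /sg normrX normrN1 expr1n mulr1 /hb /g; case: ifP => _; last first.
      by rewrite walsh_norm mulr1 add0r.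
    rewrite !normrM rad_norm mulr1 (ger0_norm (wt_ge0 R l)) mulrA -expr2 wt_sqr.
    have : 0 <= (2 ^+ l : R) by rewrite exprn_ge0.
    have := wt_ge0 R l; case: (_ == _) => /=; rewrite ?mulr1n ?mulr0n ?normr1 ?normr0; lra.
  rewrite big_split /= lerD2r -!(big_mkord xpredT g) -!(big_mkord xpredT (fun l => 2 ^+ l : R)).
  rewrite (big_cat_nat (n := L))//=; last by lia.
  rewrite [X in _ + X]big_nat_cond [X in _ + X]big1 ?addr0; last first.
    by move=> l /andP[/andP[h _] _]; rewrite /g ltnNge h.
  rewrite le_eqVlt; apply/orP; left; apply/eqP; apply: eq_big_nat => l /andP[_ h].
  by rewrite /g h.
have := sum_wt R (2 * L).
have -> : wt R (2 * L) = 2 ^+ L by rewrite /wt mulnC exprM sqrtr_sqr ger0_norm// exprn_ge0.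
have -> : \sum_(l < L) (2 ^+ l : R) = 2 ^+ L - 1.
  by have := subrX1 (2 : R) L; rewrite -natr1 addrK mul1r.
have : 0 < (2 ^+ L : R) by rewrite exprn_gt0.
lra.
Qed.

Lemma dep_thf i : (c < 2 ^ p)%N -> (i < 2 ^ (2 * L))%N -> dep (p + 4 * L)%N (thf i).
Proof.
move=> c_lt iL w w' ww; rewrite /thf /haar; congr (_ * _); congr (_ + _).
  by apply: (walsh_dep R c_lt) => j jp; apply: ww; lia.
apply: eq_bigr => -[l lL] _ /=; congr (_ * _); rewrite /hb; case: ltnP => hl.
  congr (_ * _ * _); last by rewrite /rad ww//; lia.
  by congr ((_ == _)%:R); apply: eq_chunk => j hj; apply: ww; lia.
have H : ucode l ((2 ^ l + i %/ 2 ^ (2 * L - l)) * 2 ^ p)%N.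
  by rewrite /ucode ltnNge hl /=; exists (i %/ 2 ^ (2 * L - l))%N => //; exact: cell_lt.
by have /andP[_ h] := ucode_lt lL H; apply: (walsh_dep R h).
Qed.

Lemma walsh_chunk q l s : (s < 2 ^ l)%N ->
  exists phi : nat -> R, forall w, walsh R (s * 2 ^ q)%N w = phi (chunk q l w).
Proof.
elim: l s => [|l IH] s hs.
  exists (fun=> 1) => w; have -> : s = 0%N by rewrite expn0 in hs; lia.
  by rewrite mul0n walsh0.
have [h|h] := ltnP s (2 ^ l).
  have [phi hphi] := IH s h; exists (fun u => phi u./2) => w.
  by rewrite chunk_half.
have hs' : (s - 2 ^ l < 2 ^ l)%N by rewrite expnS in hs; lia.
have [phi hphi] := IH _ hs'; exists (fun u => phi u./2 * sg R (odd u)) => w.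
rewrite chunk_half odd_chunk -hphi -/(rad R (q + l)%N w) -walshD.
  by congr walsh; rewrite addnC expnD mulnBl; nia.
by rewrite expnD mulnC ltn_mul2l expn_gt0.
Qed.

(** After [haar_span], a frequency of a level below [L] is the sign of that level times a function
    of the cell, hence a combination of the [hb l v] over the cells [v]. *)
Lemma thf_span (P : (digits -> R) -> Prop) :
  (forall a b f g, P f -> P g -> P (fun w => a * f w + b * g w)) ->
  (forall i, (i < 2 ^ (2 * L))%N -> P (thf i)) ->
  forall n, tcode n -> P (walsh R n).
Proof.
move=> Plin hP.
have [|Pc Ph] := @haar_span R P (2 * L)%N (walsh R c) hb Plin.
  move=> i /hP h; have := Plin (2 ^+ L) 0 _ _ h h; congr P; apply/funext => w.
  by rewrite mul0r addr0 /thf mulrA mulfV ?mul1r// expf_neq0 ?pnatr_eq0.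
move=> n [->//|[l lL]]; have {}Ph v := Ph l v lL.
rewrite /ucode /hb in Ph *; case: ltnP => hl in Ph *; last first.
  by move=> [v vl ->]; exact: Ph.
move=> [s sl ->]; have [phi hphi] := walsh_chunk (p + 2 * L) sl.
have P0 : P (fun=> 0).
  by have := Plin 0 0 _ _ Pc Pc; congr P; apply/funext => w; rewrite !mul0r addr0.
have H m : (m <= 2 ^ l)%N -> P (fun w => \sum_(v < m) phi v *
    ((chunk (p + 2 * L) l w == v)%:R * rad R (p + 3 * L + l)%N w)).
  elim: m => [|m IH] hm.
    by move: P0; congr P; apply/funext => w; rewrite big_ord0.
  have := Plin 1 (phi m / wt R l) _ _ (IH (ltnW hm)) (Ph m hm).
  congr P; apply/funext => w; rewrite big_ord_recr /= mul1r; congr (_ + _).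
  by rewrite -!mulrA; congr (_ * _); rewrite mulKf// gt_eqF ?wt_gt0.
have := H _ (leqnn _); congr P; apply/funext => w.
rewrite walshD ?ucode_small// hphi.
rewrite (bigD1 (Ordinal (chunk_lt (p + 2 * L) l w)))//= eqxx mul1r big1 ?addr0// => v.
by rewrite -val_eqE /= eq_sym => /negbTE ->; rewrite mul0r mulr0.
Qed.

End block.

(** * Large partial sums inside a block *)

Lemma quarter z : odd z -> ~~ odd z./2 -> z = (4 * z./2./2).+1.
Proof. by move: z => z; lia. Qed.

(** Evaluates all truncations for a cut [t] in the second quarter of the cell [[4uE, 4(u+1)E]],
    which is where a left-right turn puts it. *)
Lemma turn_pos (t T E u : nat) :
  ((4 * u).+1 * E <= t)%N -> (t <= (4 * u).+2 * E)%N -> (t <= T)%N ->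
  [/\ minn t (u.*2.+1 * (2 * E)) = t, minn t (u.+1 * (2 * (2 * E))) = t,
      minn t (u * (2 * (2 * E))) = u * (2 * (2 * E)) &
  [/\ minn t ((2 * u).*2.+1 * E) = (4 * u).+1 * E,
      minn t ((2 * u) * (2 * E)) = u * (2 * (2 * E)),
      minn t ((2 * u).+1 * (2 * E)) = t,
      minn T ((2 * u).*2.+1 * E) = (4 * u).+1 * E &
      minn T ((2 * u) * (2 * E)) = u * (2 * (2 * E))]]%N.
Proof.
move=> h1 h2 h3; split; [| | |split]; rewrite /minn; case: ltnP; nia.
Qed.

Lemma turn_exp L l : (l.+1 < L)%N ->
  [/\ L - l = (L - l.+2).+2, L - l.+1 = (L - l.+2).+1,
     2 * L - l = (L - l.+2 + L).+2, 2 * L - l.+1 = (L - l.+2 + L).+1 &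
     2 * L - l.+2 = L - l.+2 + L]%N.
Proof. by move=> h; split; lia. Qed.

Section block_event.
Variable R : rcfType.
Variables (p n cc : nat) (al : nat -> R).
Let L := n.+1.
Hypothesis c_lt : (cc < 2 ^ p)%N.

Definition bsum t w : R := \sum_(i < t) al i * thf R p L cc i w.

Let A t : R := \sum_(i < t) al i.

Let AS t : A t.+1 = A t + al t. Proof. by rewrite /A big_ord_recr. Qed.

(** The sign is [+1] on the left half of the cell [v] and [-1] on the right half, so the sum is a
    difference of two increments of [A], each truncated at [t]. *)
Lemma cell_sum m v t :
  \sum_(i < t) al i * (sg R (odd (i %/ 2 ^ m)) * (i %/ 2 ^ m.+1 == v)%N%:R) =
  2 * A (minn t (v.*2.+1 * 2 ^ m)) - A (minn t (v * 2 ^ m.+1)) - A (minn t (v.+1 * 2 ^ m.+1)).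
Proof.
elim: t => [|t IH]; first by rewrite big_ord0 !min0n; ring.
rewrite big_ord_recr /= IH.
have minS z : A (minn t.+1 z) = A (minn t z) + (t < z)%N%:R * al t.
  have -> : minn t.+1 z = if (t < z)%N then t.+1 else z by case: ltnP => h; lia.
  rewrite /minn; case: ifP => h; first by rewrite AS mulr1n mul1r.
  by rewrite mulr0n mul0r addr0.
rewrite !minS.
have e1 : (t < v.*2.+1 * 2 ^ m)%N = (t %/ 2 ^ m < v.*2.+1)%N by rewrite ltn_divLR ?expn_gt0.
have e2 : (t < v * 2 ^ m.+1)%N = (t %/ 2 ^ m < v.*2)%N.
  by rewrite ltn_divLR ?expn_gt0// expnS mulnA muln2.
have e3 : (t < v.+1 * 2 ^ m.+1)%N = (t %/ 2 ^ m < v.*2.+2)%N.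
  by rewrite ltn_divLR ?expn_gt0// expnS mulnA muln2.
have e4 : (t %/ 2 ^ m.+1 = (t %/ 2 ^ m)./2)%N by rewrite expnS mulnC divnMA divn2.
rewrite e1 e2 e3 e4.
move: (t %/ 2 ^ m)%N => k.
have -> : (k./2 == v) = (v.*2 <= k < v.*2.+2)%N by apply/eqP/idP; lia.
case: (ltngtP k v.*2) => h1; case: (ltngtP k v.*2.+1) => h2; case: (ltngtP k v.*2.+2) => h3;
  try (exfalso; lia); rewrite ?h1 ?h2 ?oddS ?odd_double /sg /= ?mulr1n ?mulr0n; try ring.
Qed.

(* The coefficient of [rad (p + 3 * L + l)] in [bsum t] on the cell [v]. *)
Definition rcoef l t v : R := 2 ^+ l / 2 ^+ L *
  (2 * A (minn t (v.*2.+1 * 2 ^ (2 * L - l.+1))) - A (minn t (v * 2 ^ (2 * L - l)))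
   - A (minn t (v.+1 * 2 ^ (2 * L - l)))).

Definition brest t w : R := \sum_(i < t) al i * ((2 ^+ L)^-1 *
  (walsh R cc w + \sum_(L <= l < 2 * L) wt R l * sg R (odd (i %/ 2 ^ (2 * L - l.+1))) *
     hb R p L l (i %/ 2 ^ (2 * L - l))%N w)).

Lemma bsumE t w : bsum t w =
  brest t w + \sum_(l < L) rcoef l t (chunk (p + 2 * L) l w) * rad R (p + 3 * L + l)%N w.
Proof.
have -> : \sum_(l < L) rcoef l t (chunk (p + 2 * L) l w) * rad R (p + 3 * L + l)%N w =
  \sum_(i < t) al i * ((2 ^+ L)^-1 * \sum_(l < L) wt R l * sg R (odd (i %/ 2 ^ (2 * L - l.+1))) *
     hb R p L l (i %/ 2 ^ (2 * L - l))%N w).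
  under [RHS]eq_bigr => i _ do rewrite mulrA mulr_sumr.
  rewrite exchange_big /=; apply: eq_bigr => -[l lL] _ /=.
  rewrite /rcoef; have e : (2 * L - l = (2 * L - l.+1).+1)%N by lia.
  rewrite e -cell_sum mulr_sumr mulr_suml; apply: eq_bigr => i _.
  rewrite /hb lL -(wt_sqr R l) [chunk _ _ _ == _]eq_sym; ring.
rewrite -big_split /=; apply: eq_bigr => i _; rewrite -mulrDr /thf /haar -mulrDr.
congr (_ * (_ * _)); rewrite -addrA; congr (_ + _).
pose g l := wt R l * sg R (odd (i %/ 2 ^ (2 * L - l.+1))) * hb R p L l (i %/ 2 ^ (2 * L - l))%N w.
rewrite -(big_mkord xpredT g) -(big_mkord xpredT g) addrC -big_cat_nat//; lia.
Qed.

(** This makes the remainder a constant while the cell digits and the sign digits are averaged. *)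
Lemma brest_dep t : (t <= 2 ^ (2 * L))%N -> dep (p + 2 * L)%N (brest t).
Proof.
move=> tT w w' ww; rewrite /brest; apply: eq_bigr => -[i it] _ /=; congr (_ * (_ * (_ + _))).
  by apply: (walsh_dep R c_lt) => j jp; apply: ww; lia.
apply: eq_big_nat => l /andP[h1 h2]; congr (_ * _); rewrite /hb ltnNge h1 /=.
have H : (i %/ 2 ^ (2 * L - l) < 2 ^ l)%N.
  by rewrite ltn_divLR ?expn_gt0// -expnD subnKC// ?(leq_trans it)// ltnW.
have lt : ((2 ^ l + i %/ 2 ^ (2 * L - l)) * 2 ^ p < 2 ^ (p + 2 * L))%N.
  rewrite (addnC p) expnD ltn_mul2r expn_gt0 /=.
  apply: (@leq_trans (2 ^ l.+1)); last by rewrite leq_exp2l//; lia.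
  by rewrite expnS; lia.
by apply: (walsh_dep R lt) => j hj; apply: ww; lia.
Qed.

Let T := (2 ^ (2 * L))%N.
(* The coefficient of [walsh cc] in the full block sum. *)
Definition bmean : R := A T / 2 ^+ L.

Definition bgood w := [forall t : 'I_T.+1, `|bsum t w| <= 1].

Let av l v : R := 2 ^+ l / 2 ^+ L *
  (A (minn T (v.+1 * 2 ^ (2 * L - l))) - A (minn T (v * 2 ^ (2 * L - l)))).
Let dl l v : R := rcoef l T v.
(** There are [4 ^ L] indices but only [2 ^ L] cells [y] of level [L]; [y * 2 ^ L] is the first
    index of the cell [y]. *)
Let D l y : R := rcoef l (y * 2 ^ L) (y %/ 2 ^ (L - l)).

Let av0 : av 0%N 0%N = bmean.
Proof.
rewrite /av subn0 mul1n mul0n minnn minn0; have -> : A 0%N = 0 by rewrite /A big_ord0.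
by rewrite subr0 expr0 div1r mulrC.
Qed.

Let avS l v : (l < L)%N -> av l.+1 v = av l v./2 + sg R (odd v) * dl l v./2.
Proof.
move=> lL; rewrite /av /dl /rcoef.
have e : (2 * L - l = (2 * L - l.+1).+1)%N by lia.
rewrite e; move: (2 * L - l.+1)%N => m; rewrite exprS expnS.
rewrite -{1 2}(odd_double_half v); case: (odd v); rewrite /= ?add0n ?add1n /sg ?expr0 ?expr1.
  have -> : (v./2.*2.+2 * 2 ^ m = v./2.+1 * (2 * 2 ^ m))%N by lia.
  by rewrite mulnA muln2; ring.
by rewrite !mulnA !muln2; ring.
Qed.

(** Let [X] be the full sum over the first quarter of the cell at level [l] and [Y] the cut sum over
    the second. Then [D l] is [X + Y] and [D l.+1] is [2 * (X - Y)], both up to the factor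
    [2 ^ l / 2 ^ L]. The unknown [Y] drops out of [2 * D l + D l.+1], leaving the scaled average of
    the first quarter. *)
Let D_turn l y : (y < 2 ^ L)%N -> (l < n)%N ->
  ~~ odd (y %/ 2 ^ (L - l.+1))%N -> odd (y %/ 2 ^ (L - l.+2))%N ->
  2 * D l y + D l.+1 y = av l.+1 (y %/ 2 ^ (L - l.+1))%N + dl l.+1 (y %/ 2 ^ (L - l.+1))%N.
Proof.
move=> yL ln o1 o2; rewrite /D /av /dl /rcoef.
have [eLl eLl1 e1 e2 e3] := @turn_exp L l ln.
rewrite eLl eLl1 in o1 o2 *; rewrite e1 e2 e3.
move: (L - l.+2)%N o1 o2 => m; rewrite ![in X in (X -> _)]expnS.
set z := (y %/ 2 ^ m)%N => o1 o2.
have f1 : (y %/ 2 ^ m.+1 = z./2)%N by rewrite expnS mulnC divnMA divn2.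
have f2 : (y %/ 2 ^ m.+2 = z./2./2)%N by rewrite expnS mulnC divnMA divn2 f1.
rewrite f1 f2; set u := (z./2./2)%N.
have zu : z = (4 * u).+1 by apply: quarter => //; rewrite -f1 expnS.
have g1 : (z * 2 ^ m <= y)%N by exact: leq_divM.
have g2 : (y < z.+1 * 2 ^ m)%N by rewrite ltn_ceil ?expn_gt0.
have hz : z./2 = (2 * u)%N.
  by rewrite zu /= uphalf_half -[(4)%N]/(2 * 2)%N -mulnA mul2n half_double odd_double.
rewrite hz; set C := (2 ^ L)%N; rewrite !expnS expnD -/C; set B := (2 ^ m)%N in g1 g2 *.
have g3 : (z * (B * C) <= y * C)%N by rewrite mulnA leq_mul2r g1 orbT.
have g4 : (y * C <= z.+1 * (B * C))%N by rewrite mulnA leq_mul2r ltnW ?orbT.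
have g5 : (y * C <= T)%N by rewrite /T mul2n -addnn expnD leq_mul2r ltnW ?orbT.
rewrite zu in g3 g4; move: (B * C)%N g3 g4 => E g3 g4; move: (y * C)%N g3 g4 g5 => t g3 g4 g5.
have [-> -> -> [-> -> -> -> ->]] := turn_pos g3 g4 g5.
by rewrite exprS; ring.
Qed.

Let big := bigset n dl D.

Lemma bgood_le t w : (t <= T)%N -> (bgood w)%:R <= 1 - (1 < `|bsum t w|)%R%:R :> R.
Proof.
move=> tT; case: ltP => h; rewrite ?mulr1n ?mulr0n ?subr0; last first.
  by case: (bgood w); rewrite ?lexx ?ler01.
rewrite subrr; have -> : bgood w = false; last by [].
apply/negbTE/forallPn; exists (Ordinal (n := T.+1) (m := t) tT); by rewrite -ltNge.
Qed.

Let agree_chunk q m w v : (p + 2 * L <= q)%N -> (q + m <= p + 3 * L)%N ->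
  agree_off (p + 3 * L) L v w -> chunk q m v = chunk q m w.
Proof. by move=> h1 h2 vw; apply: eq_chunk => i hi; apply: vw; lia. Qed.

(** With the cell [y] fixed, only the [L] signs are random. The two alternatives in [bigset]
    correspond to the cut [y * 2 ^ L] and to the full sum; [bgood] ranges over all cuts, so the cut
    may vary with [y]. *)
Let inner w : avgs (p + 3 * L) L (fun w => (bgood w)%:R) w <=
  1 + - 12^-1 * (big (chunk (p + 2 * L) L w))%:R :> R.
Proof.
set y := chunk _ _ _.
have pre l : (l <= L)%N -> chunk (p + 2 * L) l w = (y %/ 2 ^ (L - l))%N.
  by move=> lL; rewrite -(chunk_divn _ l (L - l)) subnKC.
have main t : (t <= T)%N -> 2 <= \sum_(l < L) rcoef l t (y %/ 2 ^ (L - l)) ^+ 2 ->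
   avgs (p + 3 * L) L (fun w => (bgood w)%:R) w <= 1 + - 12^-1 :> R.
  move=> tT h.
  pose Z v := brest t w + \sum_(l < L) rcoef l t (y %/ 2 ^ (L - l)) * rad R (p + 3 * L + l)%N v.
  apply: (@le_trans _ _ (avgs (p + 3 * L) L (fun v => 1 + -1 * (1 < `|Z v|)%R%:R) w)).
    apply: ler_avgs => v vw; rewrite mulN1r; apply: le_trans (bgood_le v tT) _.
    rewrite bsumE /Z (@brest_dep t tT v w); last by move=> i hi; apply: vw; lia.
    rewrite (eq_bigr (fun l : 'I_L => rcoef l t (y %/ 2 ^ (L - l)) * rad R (p + 3 * L + l)%N v))//.
    by move=> [l lL] _ /=; rewrite (@agree_chunk (p + 2 * L)%N l w v)// ?pre//; lia.
  rewrite avgsD avgsZ avgs_cst lerD2l mulN1r lerN2.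
  exact: (@avgs_rad_gt1 R _ (brest t w) (fun l => rcoef l t (y %/ 2 ^ (L - l))%N)).
have yL : (y < 2 ^ L)%N by exact: chunk_lt.
have [| _] := boolP (big y); last first.
  rewrite mulr0n mulr0 addr0 -[leRHS](avgs_cst (p + 3 * L) L _ w).
  by apply: ler_avgs => v _; case: (bgood v); rewrite ?lexx ?ler01.
rewrite mulr1n mulr1 => /orP[] h; [apply: (main (y * 2 ^ L)%N)|apply: (main T)] => //.
by rewrite /T mul2n -addnn expnD leq_mul2r ltnW ?orbT.
Qed.

Lemma avgs_bgood w : bmean != 0 -> (0 < n)%N ->
  avgs p (4 * L) (fun w => (bgood w)%:R) w <=
  1 - 12^-1 * (bmean ^+ 2 / (16 * (bmean ^+ 2 + 2)) - 224 / (bmean ^+ 2 * n%:R)) :> R.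
Proof.
move=> c0 n0.
(* The windows hold the digits of the high levels, of the cell and of the signs; they are averaged
   from the last to the first. *)
have -> : (4 * L = 2 * L + (L + L))%N by lia.
rewrite avgs_cat -[leRHS](avgs_cst p (2 * L) _ w); apply: ler_avgs => v _.
rewrite avgs_cat; have -> : (p + 2 * L + L = p + 3 * L)%N by lia.
apply: (@le_trans _ _ (avgs (p + 2 * L) L
    (fun w => 1 + - 12^-1 * (big (chunk (p + 2 * L) L w))%:R) v)).
  by apply: ler_avgs => u _; exact: inner.
rewrite avgsD avgsZ avgs_cst (avgs_chunk _ _ (fun y => (big y)%:R)).
rewrite mulNr lerD2l lerN2 ler_wpM2l ?invr_ge0//.
(* The tree has depth [L = n.+1], but a turn takes two steps, so only [n] levels can host one. *)
by apply: (tavg_bigset (av := av)) => // l v' h; rewrite avS.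
Qed.

End block_event.

(** * The orthonormal system *)

Section system.
Variable R : rcfType.
Variable n_ : nat -> nat.

Let L k := (n_ k).+1.

(** Starting at 1 keeps digit 0 out of every level function [hb]; it is the digit flipped later. *)
Fixpoint start k : nat := if k is k'.+1 then (start k' + 4 * L k')%N else 1%N.

Lemma start_gt k : (k < start k)%N.
Proof. elim: k => [//|k IH] /=; rewrite /L; lia. Qed.

Lemma start_gt0 k : (0 < start k)%N.
Proof. by have := start_gt k; lia. Qed.

Lemma start_le k k' : (k <= k')%N -> (start k <= start k')%N.
Proof. by move=> /subnK <-; elim: (k' - k)%N => [//|d]; rewrite addSn /=; lia. Qed.

Let cc k := (2 * k).+1.

Lemma cc_lt k : (cc k < 2 ^ start k)%N.
Proof.
apply: (@leq_trans (2 ^ k.+1)); last by rewrite leq_exp2l// start_gt.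
by have := ltn_expl k (ltnSn 1); rewrite /cc expnS; lia.
Qed.

Let cc_odd k : odd (cc k). Proof. by rewrite /cc /= mul2n odd_double. Qed.

Definition width k := (2 ^ (2 * L k))%N.

Definition used m := exists k l, (l < 2 * L k)%N /\ ucode (start k) (L k) l m.

(* The even frequency [2 k] is added to block [k] when no block spans it, which
   makes the system complete. *)
Definition blk k : seq (digits -> R) :=
  [seq thf R (start k) (L k) (cc k) i | i <- iota 0 (width k)] ++
  (if `[< used (2 * k) >] then [::] else [:: walsh R (2 * k)]).

Definition zf : digits -> R := fun=> 0.

Definition offs k := size (flatten [seq blk j | j <- iota 0 k]).

(** Each block is nonempty, so the first [n.+1] blocks already contain position [n]. *)
Definition sys n : digits -> R := nth zf (flatten [seq blk j | j <- iota 0 n.+1]) n.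

Lemma size_blk k : (width k <= size (blk k))%N.
Proof. by rewrite size_cat size_map size_iota leq_addr. Qed.

Lemma offsS k : offs k.+1 = (offs k + size (blk k))%N.
Proof. by rewrite /offs -addn1 iotaD map_cat flatten_cat size_cat /= cats0. Qed.

Lemma offs_ge k : (k <= offs k)%N.
Proof.
elim: k => [//|k IH]; rewrite offsS.
have := size_blk k; have : (0 < width k)%N by rewrite expn_gt0.
lia.
Qed.

Lemma sysE k i : (i < size (blk k))%N -> sys (offs k + i) = nth zf (blk k) i.
Proof.
move=> ik; rewrite /sys; have := offs_ge k => h.
have -> : (offs k + i).+1 = (k + (1 + (offs k + i - k)))%N by lia.
rewrite iotaD map_cat flatten_cat nth_cat -/(offs k) ltnNge leq_addr /= addKn.
by rewrite add0n nth_cat ik.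
Qed.

Lemma sysP n : exists k i, (i < size (blk k))%N /\ n = (offs k + i)%N.
Proof.
have H K : (n < offs K)%N -> exists k i, (i < size (blk k))%N /\ n = (offs k + i)%N.
  elim: K => [//|K IH]; have [/IH//|h] := ltnP n (offs K).
  rewrite offsS => h2; exists K, (n - offs K)%N; split; lia.
by apply: (H n.+1); exact: offs_ge.
Qed.

Lemma nth_blk k i : (i < width k)%N -> nth zf (blk k) i = thf R (start k) (L k) (cc k) i.
Proof.
move=> h; rewrite nth_cat size_map size_iota h (nth_map 0%N) ?size_iota//.
by rewrite nth_iota.
Qed.

Lemma nth_blk_last k i : (width k <= i)%N -> (i < size (blk k))%N ->
  [/\ ~ used (2 * k), i = width k & nth zf (blk k) i = walsh R (2 * k)].
Proof.
rewrite size_cat size_map size_iota => h h2; rewrite nth_cat size_map size_iota ltnNge h /=.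
move: h2; case: asboolP => [_|u] /=; first by rewrite addn0 ltnNge h.
rewrite addn1 ltnS => h2; have -> : i = width k by lia.
by rewrite subnn.
Qed.

Definition bcode k i : nat -> Prop :=
  if (i < width k)%N then tcode (start k) (L k) (cc k) else eq (2 * k)%N.

Lemma spec_blk k i : (i < size (blk k))%N -> spec (bcode k i) (nth zf (blk k) i).
Proof.
move=> ik; rewrite /bcode; case: ltnP => h; first by rewrite nth_blk//; exact: spec_thf.
by have [_ _ ->] := nth_blk_last h ik; apply: (@spec_walsh R (eq (2 * k)%N)).
Qed.

Lemma tcode_disj k k' n : (k < k')%N ->
  tcode (start k) (L k) (cc k) n -> tcode (start k') (L k') (cc k') n -> False.
Proof.
move=> kk [->|[l lL u]] [e|[l' l'L u']].
- by move: e; rewrite /cc; lia.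
- by have := ucode_even (start_gt0 k') u'; rewrite cc_odd.
- by have := ucode_even (start_gt0 k) u; rewrite e cc_odd.
have /andP[_ h1] := ucode_lt lL u; have /andP[h2 _] := ucode_lt l'L u'.
have h3 : (2 ^ start k.+1 <= 2 ^ start k')%N by rewrite leq_exp2l// start_le.
move: h1; rewrite ltnNge => /negP; apply; exact: leq_trans h3 h2.
Qed.

Lemma mean_sys m n : mean (fun w => sys m w * sys n w) (m == n)%:R.
Proof.
have [k [i [ik ->]]] := sysP m; have [k' [i' [ik' ->]]] := sysP n.
rewrite !sysE//.
have meanC f g e : mean (fun w => f w * g w) e -> mean (fun w => g w * f w : R) e.
  by congr mean; apply/funext => w; rewrite mulrC.
have sep k1 k2 i1 i2 : (k1 < k2)%N -> (i1 < size (blk k1))%N ->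
    (offs k1 + i1 < offs k2 + i2)%N.
  move=> h1 h2; apply: (@leq_trans (offs k1.+1)); first by rewrite offsS ltn_add2l.
  apply: leq_trans (leq_addr _ _); rewrite -(subnK h1).
  by elim: (k2 - _)%N => [//|d IH]; rewrite addSn [X in (_ <= X)%N]offsS; lia.
have H k1 k2 i1 i2 : (i1 < size (blk k1))%N -> (i2 < size (blk k2))%N -> (k1 < k2)%N ->
    mean (fun w => nth zf (blk k1) i1 w * nth zf (blk k2) i2 w) 0.
  move=> h1 h2 h; apply: spec_orth (spec_blk h1) (spec_blk h2) => c.
  rewrite /bcode; case: ltnP => j1; case: ltnP => j2.
  - exact: tcode_disj.
  - have [nu _ _] := nth_blk_last j2 h2.
    move=> [->|[l lL u]] e; first by move: e; rewrite /cc; lia.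
    by apply: nu; exists k1, l; rewrite e.
  - have [nu _ _] := nth_blk_last j1 h1.
    move=> e [e2|[l lL u]]; first by move: e2; rewrite -e /cc; lia.
    by apply: nu; exists k2, l; rewrite e.
  - by move=> <-; lia.
have [kk|kk|kk] := ltngtP k k'.
- by rewrite ltn_eqF ?sep//; apply: H.
- by rewrite gtn_eqF ?sep//; apply: meanC; apply: H.
subst k'; rewrite eqn_add2l.
have [j1|j1] := ltnP i (width k); have [j2|j2] := ltnP i' (width k).
- by rewrite !nth_blk//; apply: mean_thf => //; exact: start_gt0.
- have [nu e ->] := nth_blk_last j2 ik'; rewrite nth_blk// e ltn_eqF//.
  apply: spec_orth (spec_thf R _ _ j1) (@spec_walsh R (eq (2 * k)%N) _ erefl) => c.
  move=> [->|[l lL u]] e2; first by move: e2; rewrite /cc; lia.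
  by apply: nu; exists k, l; rewrite e2.
- have [nu e ->] := nth_blk_last j1 ik; rewrite nth_blk// e gtn_eqF//.
  apply: meanC; apply: spec_orth (spec_thf R _ _ j2) (@spec_walsh R (eq (2 * k)%N) _ erefl) => c.
  move=> [->|[l lL u]] e2; first by move: e2; rewrite /cc; lia.
  by apply: nu; exists k, l; rewrite e2.
- have [_ e1 ->] := nth_blk_last j1 ik; have [_ e2 ->] := nth_blk_last j2 ik'.
  by rewrite e1 e2 eqxx; have := mean_walsh R (2 * k) (2 * k); rewrite eqxx.
Qed.

Lemma sys_bound n w : `|sys n w| <= 5.
Proof.
have [k [i [ik ->]]] := sysP n; rewrite sysE//.
have [h|h] := ltnP i (width k); first by rewrite nth_blk// thf_bound.
have [_ _ ->] := nth_blk_last h ik; rewrite walsh_norm; lra.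
Qed.

Lemma dep_blk k i : (i < size (blk k))%N -> dep (start k.+1) (nth zf (blk k) i).
Proof.
move=> ik; have [h|h] := ltnP i (width k).
  by rewrite nth_blk//; apply: dep_thf => //; exact: cc_lt.
have [_ _ ->] := nth_blk_last h ik; apply: walsh_dep.
apply: (@leq_trans (2 ^ start k)); last by rewrite leq_exp2l// start_le.
by have := cc_lt k; rewrite /cc; lia.
Qed.

Lemma dep_sys n : exists m, dep m (sys n).
Proof.
have [k [i [ik ->]]] := sysP n; rewrite sysE//.
by exists (start k.+1); exact: dep_blk.
Qed.

Section span.
Variable P : (digits -> R) -> Prop.
Hypothesis Plin : forall a b f g, P f -> P g -> P (fun w => a * f w + b * g w).
Hypothesis Psys : forall n, P (sys n).

Lemma sys_walsh n : P (walsh R n).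
Proof.
have Pt k c : tcode (start k) (L k) (cc k) c -> P (walsh R c).
  apply: (thf_span Plin) => i iw.
  by have := Psys (offs k + i); rewrite sysE ?nth_blk// (leq_trans iw)// size_blk.
rewrite -(odd_double_half n) -mul2n; case: (odd n); first by apply: (Pt n./2); left.
rewrite add0n; set k := n./2.
have [[k' [l [lL u]]] | nu] := asboolP (used (2 * k)); first by apply: (Pt k'); right; exists l.
have sk : size (blk k) = (width k).+1.
  by rewrite size_cat size_map size_iota (asboolF nu) addn1.
have := Psys (offs k + width k); rewrite sysE ?sk//.
by have [|_ _ ->] := @nth_blk_last k (width k) (leqnn _); rewrite ?sk.
Qed.

(** Splitting by the digit [m] writes [F] as [G + H * rad m] with [G] and [H] functions of the first
    [m] digits. *)
Lemma sys_dep m F : dep m F -> P F.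
Proof.
elim: m F => [|m IH] F dF.
  have := Plin (F (fun=> false)) 0 (sys_walsh 0) (sys_walsh 0); congr P.
  by apply/funext => w; rewrite walsh0 mulr1 mul0r addr0; apply: dF.
suff H G : dep m G -> P (fun w => G w * rad R m w).
  pose F0 w := F (upd w m false); pose F1 w := F (upd w m true).
  have d b : dep m (fun w => F (upd w m b)).
    move=> w w' ww; apply: dF => i im; rewrite /upd; case: eqP => // ne; apply: ww; lia.
  have h1 := Plin 2^-1 2^-1 (IH _ (d false)) (IH _ (d true)).
  have h2 := Plin 2^-1 (- 2^-1) (H _ (d false)) (H _ (d true)).
  have := Plin 1 1 h1 h2; congr P; apply/funext => w.
  rewrite !mul1r -[in RHS](upd_id w m) /rad /sg; case: (w m); rewrite /= ?expr0 ?expr1; by field.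
move=> dG.
(* [P] is not assumed closed under multiplication by [rad m]. The expansion is redone for an
   arbitrary linear class [Q], then applied to the [f] with [f * rad m] in [P]. *)
have {}IH : forall Q : (digits -> R) -> Prop,
    (forall a b f g, Q f -> Q g -> Q (fun w => a * f w + b * g w)) ->
    (forall n, (n < 2 ^ m)%N -> Q (walsh R n)) -> Q G.
  clear IH dF F; elim: m G dG => [|m IH] G dG Q Ql Qw.
    have q0 := Qw 0%N isT; have := Ql (G (fun=> false)) 0 _ _ q0 q0; congr Q.
    by apply/funext => w; rewrite walsh0 mulr1 mul0r addr0; apply: dG.
  have d b : dep m (fun w => G (upd w m b)).
    move=> w w' ww; apply: dG => i im; rewrite /upd; case: eqP => // ne; apply: ww; lia.
  have q1 b : Q (fun w => G (upd w m b)).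
    by apply: (IH _ (d b) Q Ql) => n nm; apply: Qw; rewrite expnS; lia.
  have q2 b : Q (fun w => G (upd w m b) * rad R m w).
    apply: (IH _ (d b) (fun f => Q (fun w => f w * rad R m w))) => [a a' f g hf hg|n nm].
      have := Ql a a' _ _ hf hg; congr Q; apply/funext => w; ring.
    have := Qw (n + 2 ^ m)%N; rewrite expnS => /(_ ltac:(lia)); congr Q.
    by apply/funext => w; rewrite walshD.
  have h1 := Ql 2^-1 2^-1 _ _ (q1 false) (q1 true).
  have h2 := Ql 2^-1 (- 2^-1) _ _ (q2 false) (q2 true).
  have := Ql 1 1 _ _ h1 h2; congr Q; apply/funext => w.
  rewrite !mul1r -[in RHS](upd_id w m) /rad /sg; case: (w m); rewrite /= ?expr0 ?expr1; by field.
apply: (IH (fun f => P (fun w => f w * rad R m w))) => [a b f g hf hg|n nm].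
  have := Plin a b hf hg; congr P; apply/funext => w; ring.
have := sys_walsh (n + 2 ^ m); congr P; apply/funext => w; exact: walshD.
Qed.

End span.

Section series.
Variable a : nat -> R.

Definition psum N w : R := \sum_(n < N) a n * sys n w.

Definition coefs k i := a (offs k + i)%N.

Definition root_coef k : R := bmean (n_ k) (coefs k).

Definition good k w := bgood (start k) (n_ k) (cc k) (coefs k) w.

Lemma psum_block k t w : (t <= size (blk k))%N ->
  psum (offs k + t) w = psum (offs k) w + \sum_(i < t) coefs k i * nth zf (blk k) i w.
Proof.
move=> tk; rewrite /psum big_split_ord /=; congr (_ + _).
by apply: eq_bigr => -[i it] _ /=; rewrite sysE// (leq_trans it).
Qed.

Lemma psum_bsum k t w : (t <= width k)%N ->
  psum (offs k + t) w - psum (offs k) w = bsum (start k) (n_ k) (cc k) (coefs k) t w.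
Proof.
move=> tk; rewrite psum_block ?(leq_trans tk) ?size_blk// addrAC subrr add0r.
by apply: eq_bigr => -[i it] _ /=; rewrite nth_blk// (leq_trans it).
Qed.

Let hb_flip k l v w : hb R (start k) (L k) l v (flip 0 w) = hb R (start k) (L k) l v w.
Proof.
have f i : (0 < i)%N -> flip 0 w i = w i by case: i.
have p0 := start_gt0 k; rewrite /hb; case: ifP => _.
  congr (_ * (_ == _)%:R * _); first by apply: eq_chunk => i hi; apply: f; lia.
  by rewrite /rad f//; lia.
rewrite walsh_flip /bit divn1 oddM oddX (negbTE (_ : ~~ (start k == 0)%N)) ?andbF; last by lia.
by rewrite /sg expr0 mul1r.
Qed.

Lemma blk_flip k i w : (i < size (blk k))%N ->
  nth zf (blk k) i w - nth zf (blk k) i (flip 0 w) =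
  (i < width k)%N%:R * (2 / 2 ^+ L k * walsh R (cc k) w).
Proof.
move=> ik; case: ltnP => h; last first.
  have [_ _ ->] := nth_blk_last h ik.
  by rewrite walsh_flip /bit divn1 mul2n odd_double /sg expr0 mul1r subrr mul0r.
rewrite nth_blk// mul1r /thf /haar -mulrBr walsh_flip /bit divn1 cc_odd /sg expr1.
rewrite (eq_bigr (fun l : 'I_(2 * L k) => wt R l * sg R (odd (i %/ 2 ^ (2 * L k - l.+1))) *
  hb R (start k) (L k) l (i %/ 2 ^ (2 * L k - l))%N (flip 0 w))); last first.
  by move=> l _; rewrite hb_flip.
by field; rewrite expf_neq0 ?pnatr_eq0.
Qed.

Lemma psum_flip K w : psum (offs K) w - psum (offs K) (flip 0 w) =
  2 * \sum_(k < K) root_coef k * walsh R (cc k) w.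
Proof.
elim: K => [|K IH]; first by rewrite /psum big_ord0 !big_ord0 subr0 mulr0.
rewrite offsS !psum_block// big_ord_recr /= mulrDr -IH.
have -> : 2 * (root_coef K * walsh R (cc K) w) =
   \sum_(i < size (blk K)) coefs K i * nth zf (blk K) i w -
   \sum_(i < size (blk K)) coefs K i * nth zf (blk K) i (flip 0 w).
  rewrite -sumrB.
  under [RHS]eq_bigr => i _ do rewrite -mulrBr blk_flip//.
  rewrite -(big_mkord xpredT (fun i => coefs K i *
     ((i < width K)%N%:R * (2 / 2 ^+ L K * walsh R (cc K) w)))).
  rewrite (big_cat_nat (n := width K))//=; last exact: size_blk.
  rewrite [X in _ = _ + X]big_nat_cond [X in _ = _ + X]big1 ?addr0; last first.
    by move=> i /andP[/andP[h _] _]; rewrite ltnNge h /= mul0r mulr0.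
  rewrite /root_coef /bmean -(big_mkord xpredT (coefs K)) mulr_suml mulr_suml mulr_sumr.
  by apply: eq_big_nat => i /andP[_ h]; rewrite h mul1r; ring.
ring.
Qed.

Lemma dep_good k : dep (start k.+1) (good k).
Proof.
move=> w w' ww; rewrite /good /bgood; apply: eq_forallb => -[t tT] /=.
congr (`| _ | <= 1); apply: eq_bigr => -[i it] _ /=; congr (_ * _).
apply: (dep_thf R (cc_lt k) _ ww).
by rewrite (leq_trans it).
Qed.

Definition goods k0 K w := [forall k : 'I_K, (k0 <= k)%N ==> good k w].

Lemma dep_goods k0 K : dep (start K) (goods k0 K).
Proof.
move=> w w' ww; apply: eq_forallb => -[k kK] /=; congr (_ ==> _).
by apply: dep_good => i ik; apply: ww; apply: leq_trans ik _; exact: start_le.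
Qed.

Lemma goodsS k0 K w : (k0 <= K)%N -> goods k0 K.+1 w = goods k0 K w && good K w.
Proof.
move=> kK; apply/forallP/andP => [h|[/forallP h1 h2] k].
  split; last by have := h ord_max; rewrite kK.
  by apply/forallP => k; have := h (widen_ord (leqnSn K) k).
apply/implyP => kk; have [hk|hk] := ltnP k K.
  by have := h1 (Ordinal hk); rewrite /= kk.
by have -> : k = K :> nat by have := ltn_ord k; lia.
Qed.

(* A lower bound for the conditional probability that some partial sum of block
   [k] exceeds 1 in absolute value. *)
Definition esc k : R := if k.+1%:R^-1 <= `|root_coef k|
  then root_coef k ^+ 2 / (384 * (root_coef k ^+ 2 + 2)) else 0.

Lemma esc_ge0 k : 0 <= esc k.
Proof.
rewrite /esc; case: ifP => _; last exact: lexx.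
apply: divr_ge0; first exact: sqr_ge0.
by rewrite mulr_ge0 ?ler0n// addr_ge0 ?sqr_ge0 ?ler0n.
Qed.

Lemma esc_le1 k : esc k <= 1.
Proof.
rewrite /esc; case: ifP => _; last exact: ler01.
by move: (root_coef k) => x; have := sqr_ge0 x => h; rewrite ler_pdivrMr; lra.
Qed.

(* [21504 = 3 * 32 * 224]: when [1 / (k + 1) <= `|root_coef k|], the error term of
   [avgs_bgood] is at most half of its main term. *)
Hypothesis n_gt0 : forall k, (0 < n_ k)%N.
Hypothesis n_big : forall k, 21504 * k.+1%:R ^+ 4 <= (n_ k)%:R :> R.

Lemma avgs_good k w : avgs (start k) (4 * L k) (fun w => (good k w)%:R) w <= 1 - esc k.
Proof.
rewrite /esc; case: ifP => h; last first.
  rewrite subr0 -[leRHS](avgs_cst (start k) (4 * L k) 1 w); apply: ler_avgs => v _.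
  by case: (good k v); rewrite ?lexx ?ler01.
have k0 : 0 < k.+1%:R :> R by rewrite ltr0n.
have c0 : root_coef k != 0.
  by rewrite -normr_gt0 (lt_le_trans _ h)// invr_gt0.
apply: le_trans (avgs_bgood (cc_lt k) w c0 (n_gt0 k)) _.
rewrite -/(root_coef k) lerD2l lerN2.
have hx : (k.+1%:R ^+ 2)^-1 <= root_coef k ^+ 2.
  rewrite -exprVn -[leRHS]real_normK ?num_real//.
  by rewrite ler_pXn2r ?nnegrE ?invr_ge0 ?(ltW k0) ?normr_ge0.
have := n_big k; have n0 : 0 < (n_ k)%:R :> R by rewrite ltr0n.
move: (root_coef k ^+ 2) (n_ k)%:R n0 hx => x n n0 hx hn.
have K2 : 0 < k.+1%:R ^+ 2 :> R by rewrite exprn_gt0.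
have x0 : 0 < x by rewrite (lt_le_trans _ hx)// invr_gt0.
have h1 : 1 <= x * k.+1%:R ^+ 2 by rewrite -ler_pdivrMr// div1r.
have K1 : 1 <= k.+1%:R ^+ 2 :> R by rewrite exprn_ege1// ler1n.
have {}hn : 21504 * (k.+1%:R ^+ 2) ^+ 2 <= n by rewrite -exprM.
(* [7168 = 32 * 224]. With [y = k.+1 ^ 2], both [1] and [x] are at most [(x * y) ^ 2], so
   [x + 2 <= 3 * (x * y) ^ 2]. *)
have h2 : 7168 * (x + 2) <= x ^+ 2 * n.
  apply: (@le_trans _ _ (x ^+ 2 * (21504 * (k.+1%:R ^+ 2) ^+ 2))); last first.
    by rewrite ler_wpM2l ?sqr_ge0.
  move: (k.+1%:R ^+ 2) K2 h1 K1 => y K2 h1 K1.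
  have : 1 <= (x * y) ^+ 2 by rewrite exprn_ege1.
  have : x <= (x * y) ^+ 2.
    rewrite exprMn expr2 -mulrA ler_peMr ?(ltW x0)//.
    by rewrite expr2 mulrA; apply: mulr_ege1.
  rewrite exprMn; lra.
have -> : x / (384 * (x + 2)) = 12^-1 * (x / (32 * (x + 2))) by field; lra.
rewrite ler_wpM2l ?invr_ge0//.
have -> : x / (16 * (x + 2)) = x / (32 * (x + 2)) + x / (32 * (x + 2)) by field; lra.
rewrite -addrA lerDl subr_ge0 ler_pdivrMr ?mulr_gt0//.
rewrite mulrAC ler_pdivlMr; last by lra.
move: h2; lra.
Qed.

(** Each block multiplies the probability by at most [1 - esc], and
    [(1 - e) * (1 + S + e) <= 1 + S]. This form bounds the sum of the [esc] without passing through
    a product. *)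
Lemma expct_goods k0 K : (k0 <= K)%N ->
  expct (start K) (fun w => (goods k0 K w)%:R) * (1 + \sum_(k0 <= k < K) esc k) <= 1.
Proof.
move=> /subnK <-; elim: (K - k0)%N => [|d IH].
  rewrite add0n big_geq// addr0 mulr1 -[leRHS](avgs_cst 0 (start k0) 1 (fun=> false)).
  by apply: ler_avgs => v _; case: (goods _ _ _); rewrite ?lexx ?ler01.
rewrite addSn; set K' := (d + k0)%N in IH *.
have kK : (k0 <= K')%N by rewrite leq_addl.
rewrite big_nat_recr//=; set S := \sum_(_ <= _ < _) _ in IH *.
have S0 : 0 <= S by apply: sumr_ge0 => i _; exact: esc_ge0.
have e0 := esc_ge0 K'; have e1 := esc_le1 K'.
have h : expct (start K' + 4 * L K')%N (fun w => (goods k0 K'.+1 w)%:R) <=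
    (1 - esc K') * expct (start K') (fun w => (goods k0 K' w)%:R).
  rewrite /expct avgs_cat add0n -avgsZ; apply: ler_avgs => v _.
  rewrite (eq_avgs (G := fun w => (goods k0 K' w)%:R * (good K' w)%:R)); last first.
    by move=> u _; rewrite goodsS// -mulnb natrM.
  have dg : dep (start K') (fun w => (goods k0 K' w)%:R : R).
    by move=> w w' ww; rewrite (dep_goods k0 ww).
  rewrite (@avgs_mull R (start K') (4 * L K') _ (fun w => (good K' w)%:R) v dg) [leRHS]mulrC.
  by rewrite ler_wpM2l// avgs_good.
have E0 : 0 <= expct (start K') (fun w => (goods k0 K' w)%:R : R).
  rewrite -[leLHS](avgs_cst 0 (start K') 0 (fun=> false)).
  by apply: ler_avgs => v _; exact: ler0n.
apply: le_trans IH; apply: le_trans (ler_wpM2r _ h) _; first by rewrite !addr_ge0.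
have h2 : (1 - esc K') * (1 + (S + esc K')) <= 1 + S by nra.
by rewrite mulrAC mulrC; apply: ler_wpM2l.
Qed.

Lemma sum_invsqr K : \sum_(k < K) (k.+1%:R ^+ 2)^-1 <= 2 :> R.
Proof.
have H k : \sum_(k < k.+1) (k.+1%:R ^+ 2)^-1 <= 2 - k.+1%:R^-1 :> R.
  elim: k => [|k IH]; first by rewrite big_ord1 expr1n invr1; lra.
  rewrite big_ord_recr /=; apply: le_trans (lerD IH (lexx _)) _.
  have h : 0 < k.+1%:R :> R by rewrite ltr0n.
  have -> : k.+2%:R = k.+1%:R + 1 :> R by rewrite -natr1.
  move: (k.+1%:R : R) h => x h; rewrite -subr_ge0.
  have -> : 2 - (x + 1)^-1 - (2 - x^-1 + ((x + 1) ^+ 2)^-1) = (x * (x + 1) ^+ 2)^-1.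
    by field; rewrite !gt_eqF//; lra.
  by rewrite invr_ge0 mulr_ge0 ?sqr_ge0// ltW.
case: K => [|K]; first by rewrite big_ord0.
by apply: le_trans (H K) _; rewrite gerBl invr_ge0.
Qed.

(** A total of at most [1 / 1999] for [esc] forces [x = root_coef k ^ 2 <= 1] above the threshold;
    then [x + 2 <= 3] gives [x <= 1152 * esc k], with [1152 = 3 * 384]. Coefficients below the
    threshold [1 / (k + 1)] contribute at most 2. *)
Lemma sum_root_coef k0 :
  (forall K, 1999 / 2000 <= expct (start K) (fun w => (goods k0 K w)%:R : R)) ->
  forall K, \sum_(k0 <= k < K) root_coef k ^+ 2 <= 4.
Proof.
move=> h K; have [kK|kK] := leqP k0 K; last by rewrite big_geq// ltnW.
have S K' : (k0 <= K')%N -> \sum_(k0 <= k < K') esc k <= 1999^-1.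
  move=> kK'; have := expct_goods kK'; have := h K'.
  set S := \sum_(_ <= _ < _) _; set E := expct _ _ => h1 h2.
  have S0 : 0 <= S by apply: sumr_ge0 => i _; exact: esc_ge0.
  have : 1999 / 2000 * (1 + S) <= 1 by apply: le_trans h2; rewrite ler_wpM2r// addr_ge0.
  lra.
have c k : (k0 <= k)%N -> root_coef k ^+ 2 <= 1152 * esc k + (k.+1%:R ^+ 2)^-1.
  move=> kk; have e1 : esc k <= 1999^-1.
    have := S k.+1 (leqW kk); rewrite big_nat_recr//=; apply: le_trans.
    by rewrite lerDr sumr_ge0// => i _; exact: esc_ge0.
  have i0 : 0 <= (k.+1%:R ^+ 2)^-1 :> R by rewrite invr_ge0 sqr_ge0.
  move: e1; rewrite /esc; case: ifP => hk; last first.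
    move=> _; rewrite mulr0 add0r -exprVn -[leLHS]real_normK ?num_real//.
    rewrite ler_pXn2r ?nnegrE ?invr_ge0//; apply: ltW.
    by rewrite ltNge hk.
  have := sqr_ge0 (root_coef k); move: (root_coef k ^+ 2) => x x0.
  have d0 : 0 < 384 * (x + 2) by lra.
  rewrite ler_pdivrMr// => e1; have x1 : x <= 1 by lra.
  apply: (@le_trans _ _ (1152 * (x / (384 * (x + 2))))); last by rewrite lerDl.
  rewrite mulrA ler_pdivlMr//; nra.
apply: (@le_trans _ _ (1152 * \sum_(k0 <= k < K) esc k + \sum_(k0 <= k < K) (k.+1%:R ^+ 2)^-1)).
  rewrite mulr_sumr -big_split /=; apply: ler_sum_nat => k /andP[kk _]; exact: c.
have : \sum_(k0 <= k < K) (k.+1%:R ^+ 2)^-1 <= 2 :> R.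
  apply: le_trans (sum_invsqr K).
  rewrite -(big_mkord xpredT (fun k => (k.+1%:R ^+ 2)^-1)) [leRHS](big_cat_nat (n := k0))//=.
  by rewrite lerDr sumr_ge0// => i _; rewrite invr_ge0 sqr_ge0.
have := S K kK; lra.
Qed.

End series.
End system.

Local Open Scope classical_set_scope.
Local Open Scope ring_scope.

(** * Transfer to the unit interval *)

Section unit_interval.
Variable R : realType.
Local Notation T := (measurableTypeR R).
Local Notation mu := (@lebesgue01 R).

Lemma lebesgue01_setT : mu setT = 1%E.
Proof.
rewrite /lebesgue01 /mrestr setTI lebesgue_measure_itv /= lte_fin ltr01.
by rewrite -EFinD subr0.
Qed.

Lemma lebesgue01_fin : fin_num_fun mu.
Proof.
move=> A mA; rewrite ge0_fin_numE ?measure_ge0//.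
apply: (@le_lt_trans _ _ (mu setT)); last by rewrite lebesgue01_setT ltry.
by apply: le_measure => //; rewrite inE.
Qed.

HB.instance Definition _ := Measure_isFinite.Build _ _ _ (@lebesgue01 R) lebesgue01_fin.

(** For [x >= 0] these are the binary digits of the fractional part, with the expansion ending in
    zeros at dyadic points. *)
Definition dig (x : T) : digits := fun i => odd (Num.trunc (2 ^+ i.+1 * x)).

Definition bits m j : digits := fun i => (i < m)%N && odd (j %/ 2 ^ (m - i.+1)).

Lemma trunc_half (y : R) : 0 <= y -> (Num.trunc (2 * y))./2 = Num.trunc y.
Proof.
move=> y0; apply/esym/eqP; rewrite truncn_eq//.
have /andP[] := truncn_itv (mulr_ge0 (ler0n R 2) y0); move: (Num.trunc _) => n.
rewrite -{1 2}(odd_double_half n) -addnS natrD -mul2n natrM => h1 h2.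
have : (odd n)%:R + (2 * n./2).+1%:R <= (2 * n./2.+1)%:R :> R.
  by rewrite -natrD ler_nat; lia.
rewrite natrM; have : 0 <= (odd n)%:R :> R by rewrite ler0n.
move: h1 h2; rewrite natrD; lra.
Qed.

Lemma dig_bits m (x : T) i : 0 <= x -> (i < m)%N ->
  dig x i = bits m (Num.trunc (2 ^+ m * x)) i.
Proof.
move=> x0 im; rewrite /dig /bits im /=; congr odd.
have -> : m = (i.+1 + (m - i.+1))%N by lia.
rewrite addKn; elim: (m - i.+1)%N => [|k IH]; first by rewrite addn0 divn1.
rewrite addnS expnS divnMA divn2 [2 ^+ (_ + _).+1]exprS -mulrA trunc_half//.
by rewrite mulr_ge0 ?exprn_ge0.
Qed.

Definition dyad m j : set T := [set x | j%:R / 2 ^+ m <= x < j.+1%:R / 2 ^+ m].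

Lemma dyadE m j : dyad m j = `[j%:R / 2 ^+ m, j.+1%:R / 2 ^+ m[%classic.
Proof. by apply/seteqP; split => x; rewrite /dyad /= in_itv. Qed.

Lemma measurable_dyad m j : measurable (dyad m j).
Proof. by rewrite dyadE; exact: measurable_itv. Qed.

Lemma dyad_trunc m j (x : T) : dyad m j x <-> 0 <= x /\ Num.trunc (2 ^+ m * x) = j.
Proof.
have m0 : 0 < 2 ^+ m :> R by rewrite exprn_gt0.
have E : (j%:R / 2 ^+ m <= x < j.+1%:R / 2 ^+ m) = (j%:R <= 2 ^+ m * x < j.+1%:R).
  by rewrite ler_pdivrMr// ltr_pdivlMr// mulrC.
rewrite /dyad /= E; split.
  move=> h; have x0 : 0 <= x.
    by have /andP[h1 _] := h; rewrite -(pmulr_rge0 _ m0) (le_trans _ h1).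
  by split => //; apply/eqP; rewrite truncn_eq// mulr_ge0// ltW.
by move=> [x0 /eqP]; rewrite truncn_eq// mulr_ge0// ltW.
Qed.

Lemma mu_dyad m j : (j < 2 ^ m)%N -> mu (dyad m j) = ((2 ^+ m)^-1)%:E.
Proof.
move=> jm; have m0 : 0 < 2 ^+ m :> R by rewrite exprn_gt0.
rewrite /lebesgue01 /mrestr setIidl; last first.
  move=> x /= /andP[h1 h2]; rewrite in_itv /=; apply/andP; split.
    by apply: le_trans h1; rewrite divr_ge0// ltW.
  by apply: le_trans (ltW h2) _; rewrite ler_pdivrMr// mul1r -natrX ler_nat.
rewrite dyadE lebesgue_measure_itv /= lte_fin ltr_pM2r ?invr_gt0// ltr_nat ltnSn.
by rewrite -EFinD -mulrBl -natrB// subSnn mul1r.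
Qed.

Lemma measurable_dig i : measurable_fun setT (fun x : T => dig x i).
Proof.
apply: (@measurable_fun_bool _ _ _ _ true); rewrite setTI.
have -> : (fun x : T => dig x i) @^-1` [set true] =
    \bigcup_n (if odd n then dyad i.+1 n else set0).
  apply/seteqP; split => x /=; last first.
    by move=> [n _]; case: ifP => // on /dyad_trunc[_ e]; rewrite /dig e.
  move=> h; exists (Num.trunc (2 ^+ i.+1 * x)) => //.
  move: (h); rewrite /dig => ->; apply/dyad_trunc; split => //.
  rewrite leNgt; apply/negP => x0; move: h; rewrite /dig.
  have -> : Num.trunc (2 ^+ i.+1 * x) = 0%N; last by [].
  apply/truncn0Pn; rewrite -ltNge.
  by rewrite (lt_trans _ ltr01)// pmulr_rlt0// exprn_gt0.
apply: bigcup_measurable => n _; case: ifP => // _; exact: measurable_dyad.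
Qed.

Lemma measurable_dep m (F : digits -> R) : dep m F -> measurable_fun setT (F \o dig : T -> R).
Proof.
elim: m F => [|m IH] F dF.
  have -> : F \o dig = cst (F (fun=> false)); last exact: measurable_cst.
  by apply/funext => x /=; apply: dF.
have -> : F \o dig = fun x : T =>
    if dig x m then F (upd (dig x) m true) else F (upd (dig x) m false).
  apply/funext => x /=; rewrite -[in LHS](upd_id (dig x) m); by case: (dig x m).
apply: measurable_fun_ifT; first exact: measurable_dig.
  apply: (IH (fun w => F (upd w m true))) => w w' ww; apply: dF => i im.
  by rewrite /upd; case: eqP => // ne; apply: ww; lia.
apply: (IH (fun w => F (upd w m false))) => w w' ww; apply: dF => i im.
by rewrite /upd; case: eqP => // ne; apply: ww; lia.
Qed.

Lemma expct_bits m (F : digits -> R) :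
  expct m F = (2 ^+ m)^-1 * \sum_(j < 2 ^ m) F (bits m j).
Proof.
have E k : \sum_(j < 2 ^ k) F (bits k j) = 2 ^+ k * expct k F.
  elim: k F => [|k IH] F.
    rewrite expr0 mul1r expn0 big_ord1 /expct /=; congr F.
  have -> : \sum_(j < 2 ^ k.+1) F (bits k.+1 j) = \sum_(j < 2 ^ k) (2 * avg k F (bits k j)).
    rewrite expnS mul2n -(big_mkord xpredT (fun j => F (bits k.+1 j))).
    rewrite -(big_mkord xpredT (fun j => 2 * avg k F (bits k j))).
    elim: (2 ^ k)%N => [|n IHn]; first by rewrite !big_geq.
    rewrite doubleS 3?big_nat_recr//= IHn -addrA; congr (_ + _).
    have e b : bits k.+1 (n.*2 + b) = upd (bits k n) k (odd b) \/ (1 < b)%N.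
      case: b => [|[|b]]; [left|left|by right]; apply/funext => i;
        rewrite /bits /upd; case: eqP => [->|ne].
      - by rewrite ltnSn subnn divn1 addn0 odd_double.
      - have [ik|ik] := ltnP i k; last by rewrite ltnS leq_eqVlt ltnNge ik orbF; move/eqP/negbTE : ne => ->.
        rewrite (ltnW (ik : (i.+1 < k.+1)%N)) /= addn0.
        have -> : (k.+1 - i.+1 = (k - i.+1).+1)%N by lia.
        by rewrite expnS divnMA divn2 doubleK.
      - by rewrite ltnSn subnn divn1 oddD odd_double.
      - have [ik|ik] := ltnP i k; last by rewrite ltnS leq_eqVlt ltnNge ik orbF; move/eqP/negbTE : ne => ->.
        rewrite (ltnW (ik : (i.+1 < k.+1)%N)) /=.
        have -> : (k.+1 - i.+1 = (k - i.+1).+1)%N by lia.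
        by rewrite expnS divnMA divn2 addn1 /= uphalf_double.
    have [e0|] := e 0%N; last by []. have [e1|] := e 1%N; last by [].
    rewrite -[in F (bits _ n.*2)](addn0 n.*2) -[in F (bits _ n.*2.+1)](addn1 n.*2) e0 e1 /avg; by field.
  by rewrite -mulr_sumr IH mulrA -exprS.
by rewrite E mulrA mulVf ?mul1r// expf_neq0.
Qed.

Lemma ae_01 : {ae mu, forall x : T, 0 <= x < 1}.
Proof.
exists (`]-oo, 0[ `|` `[1, +oo[)%classic; split.
- by apply: measurableU; exact: measurable_itv.
- rewrite /lebesgue01 /mrestr.
  have -> : (`]-oo, 0[ `|` `[1, +oo[) `&` `[0, 1]%classic = [set 1 : R].
    apply/seteqP; split => x /=; rewrite !in_itv /=; last first.
      by move=> ->; rewrite lexx ler01; split => //; right.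
    move=> [[h1|h1] /andP[h2 h3]]; first by move: h1; rewrite ltNge h2.
    by apply/eqP; rewrite eq_le h3; move: h1; rewrite andbT => ->.
  exact: lebesgue_measure_set1.
- move=> x /= /negP; rewrite negb_and -leNgt -ltNge !in_itv /= andbT.
  by move=> /orP[]; [left|right].
Qed.

Lemma integral_dig m (F : digits -> R) : dep m F ->
  (\int[mu]_x (F (dig x))%:E = (expct m F)%:E)%E.
Proof.
move=> dF.
pose g (j : 'I_(2 ^ m)) (x : T) : \bar R := ((F (bits m j))%:E * (\1_(dyad m j) x)%:E)%E.
have ig j : mu.-integrable setT (g j).
  by apply: integrableZl => //; apply: integrable_indic; exact: measurable_dyad.
transitivity (\int[mu]_x (\sum_(j <- index_enum 'I_(2 ^ m) | xpredT j) g j x))%E.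
  apply: ae_eq_integral => //.
  - by apply/measurable_EFinP; exact: measurable_dep dF.
  - by apply: emeasurable_sum => j _; exact: (measurable_int mu (ig j)).
  - apply: filterS ae_01 => x /andP[x0 x1] _.
    have h : (Num.trunc (2 ^+ m * x) < 2 ^ m)%N.
      rewrite -(ltr_nat R) natrX; apply: (@le_lt_trans _ _ (2 ^+ m * x)).
        by have /andP[] := truncn_itv (mulr_ge0 (exprn_ge0 m (ler0n R 2)) x0).
      by rewrite gtr_pMr// exprn_gt0.
    rewrite (bigD1 (Ordinal h))//= big1 ?adde0 => [|j jh].
      rewrite /g indicE mem_set /= ?mule1; last by apply/dyad_trunc.
      by congr EFin; apply: dF => i im; exact: dig_bits.
    rewrite /g indicE memNset ?mule0//= => /dyad_trunc[_ e].
    by move/eqP: jh; apply; apply/val_inj.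
rewrite integral_sum// expct_bits mulr_sumr -sumEFin; apply: eq_bigr => j _.
rewrite integralZl//; last by apply: integrable_indic; exact: measurable_dyad.
rewrite integral_indic//; last exact: measurable_dyad.
rewrite setIT [X in (_ * X)%E](mu_dyad (ltn_ord j)) -EFinM mulrC//.
Qed.

End unit_interval.

(** * Square integrable functions on the unit interval *)

Section L2.
Variable R : realType.
Local Notation T := (measurableTypeR R).
Local Notation mu := (@lebesgue01 R).
Local Notation leb := (@lebesgue_measure R).

Lemma integral01 (f : T -> \bar R) : measurable_fun setT f -> (forall x, 0 <= f x)%E ->
  (\int[mu]_x f x = \int[leb]_(x in `[0%R, 1%R]) f x)%E.
Proof.
move=> mf f0.
have m01 : measurable (`[0%R, 1%R]%classic : set T) by exact: measurable_itv.
transitivity (\int[mu]_(x in `[0%R, 1%R]) f x)%E.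
  rewrite (@ge0_negligible_integral _ _ _ mu setT (~` `[0%R, 1%R]%classic))//.
  - by rewrite setDE setCK setTI.
  - exact: measurableC.
  - by rewrite /= /lebesgue01 /mrestr setICl measure0.
have H := @eq_measure_integral _ T R `[0%R, 1%R]%classic leb mu f.
apply: H => A mA AD.
by rewrite /= /lebesgue01 /mrestr setIidl.
Qed.

Lemma bounded_integrable01 (f : T -> R) (M : R) : measurable_fun setT f ->
  (forall x, `|f x| <= M) -> mu.-integrable setT (EFin \o f).
Proof.
move=> mf fM; apply: measurable_bounded_integrable => //.
  by rewrite -ge0_fin_numE ?measure_ge0//; exact: lebesgue01_fin.
exists M; split; first exact: num_real.
by move=> N MN x _ /=; rewrite (le_trans (fM x))// ltW.
Qed.

Lemma Lfun2P (f : T -> R) : f \in Lfun mu 2%:E <->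
  measurable_fun setT f /\ (\int[mu]_x (f x ^+ 2)%:E < +oo)%E.
Proof.
split=> [fL|[mf foo]].
  have mf : measurable_fun setT f by move: fL; rewrite inE => /andP[]; rewrite inE.
  split=> //; have /integrableP[_] := Lfun2_integrable_sqr fL.
  by under eq_integral => x _ do rewrite /= ger0_norm ?sqr_ge0//.
rewrite inE; apply/andP; split; rewrite inE//= /finite_norm unlock poweR_lty//.
by under eq_integral => x _ do rewrite /= powR_mulrn// real_normK ?num_real//.
Qed.

Lemma bounded_Lfun2 (f : T -> R) (M : R) : measurable_fun setT f ->
  (forall x, `|f x| <= M) -> f \in Lfun mu 2%:E.
Proof.
move=> mf fM; apply/Lfun2P; split=> //.
have /integrableP[_] : mu.-integrable setT (EFin \o (fun x => f x ^+ 2)).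
  apply: (@bounded_integrable01 _ (M ^+ 2)); first exact: measurable_funX.
  by move=> x; rewrite normrX lerXn2r ?nnegrE// (le_trans _ (fM x)).
by under eq_integral => x _ do rewrite /= ger0_norm ?sqr_ge0//.
Qed.

Lemma Lnorm2_lt (f : T -> R) (e : R) : 0 < e ->
  (\int[mu]_x (f x ^+ 2)%:E < (e ^+ 2)%:E)%E -> ('N[mu]_2%:E[EFin \o f] < e%:E)%E.
Proof.
move=> e0 h; rewrite ltNge; apply/negP => h2; move: h; rewrite ltNge => /negP; apply.
have : ((e%:E `^ 2) <= ('N[mu]_2%:E[EFin \o f] `^ 2))%E.
  by apply: gt0_ler_poweR => //; rewrite in_itv /= ?lee_fin ?Lnorm_ge0 ?leey ?(ltW e0).
rewrite poweR_Lnorm// poweR_EFin powR_mulrn ?(ltW e0)//.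
by under [in X in (_ <= X)%E]eq_integral => x _ do
  rewrite /= powR_mulrn// real_normK ?num_real//.
Qed.

(** The squared distance has a pointwise triangle inequality with factor 2, so approximation steps
    can be chained without taking roots. *)
Definition sqdist (f g : T -> R) : \bar R := (\int[mu]_x ((f x - g x) ^+ 2)%:E)%E.

Lemma sqdist_tri (f g h : T -> R) : measurable_fun setT f -> measurable_fun setT g ->
  measurable_fun setT h -> (sqdist f h <= 2%:E * sqdist f g + 2%:E * sqdist g h)%E.
Proof.
move=> mf mg mh; rewrite /sqdist.
have m2 (u v : T -> R) : measurable_fun setT u -> measurable_fun setT v ->
    measurable_fun setT (fun x => ((u x - v x) ^+ 2)%:E : \bar R).
  by move=> mu_ mv; apply/measurable_EFinP; apply: measurable_funX; exact: measurable_funB.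
rewrite -!ge0_integralZl//; try exact: m2; try by move=> x _; rewrite lee_fin sqr_ge0.
rewrite -ge0_integralD//; last 4 first.
- by move=> x _; rewrite -EFinM lee_fin mulr_ge0 ?sqr_ge0.
- by apply: measurable_funeM; exact: m2.
- by move=> x _; rewrite -EFinM lee_fin mulr_ge0 ?sqr_ge0.
- by apply: measurable_funeM; exact: m2.
apply: ge0_le_integral => //.
- by move=> x _; rewrite lee_fin sqr_ge0.
- exact: m2.
- by apply: emeasurable_funD; apply: measurable_funeM; exact: m2.
move=> x _; rewrite -!EFinM -EFinD lee_fin; move: (f x) (g x) (h x) => a b c.
rewrite -subr_ge0; have -> : 2 * (a - b) ^+ 2 + 2 * (b - c) ^+ 2 - (a - c) ^+ 2 =
  (a - b - (b - c)) ^+ 2 by ring.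
exact: sqr_ge0.
Qed.

Lemma sqdist_cvg (f : T -> R) (fn : nat -> T -> R) (g : T -> R) :
  measurable_fun setT f -> (forall n, measurable_fun setT (fn n)) ->
  {ae mu, forall x, fn ^~ x @ \oo --> f x} ->
  mu.-integrable setT (EFin \o g) ->
  (forall n x, (fn n x - f x) ^+ 2 <= g x) ->
  forall e : R, 0 < e -> exists n, (sqdist f (fn n) < e%:E)%E.
Proof.
move=> mf mfn cv ig fg e e0.
have mD n : measurable_fun setT (fun x => ((fn n x - f x) ^+ 2)%:E : \bar R).
  by apply/measurable_EFinP; apply: measurable_funX; exact: measurable_funB.
have [||||_ _ h] := @dominated_convergence _ _ _ mu setT measurableT
    (fun n x => ((fn n x - f x) ^+ 2)%:E) (cst 0%E) (EFin \o g) mD.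
- exact: measurable_cst.
- apply: filterS cv => x cvx _.
  have h : (fun n => fn n x - f x) @ \oo --> f x - f x by apply: cvgB => //; exact: cvg_cst.
  have h2 : (fun n => (fn n x - f x) ^+ 2) @ \oo --> (0 : R).
    have -> : (fun n => (fn n x - f x) ^+ 2) = (fun n => fn n x - f x) \* (fun n => fn n x - f x).
      by apply/funext => n; rewrite expr2.
    by have := cvgM h h _; rewrite subrr mulr0; apply.
  by apply: (cvg_EFin _ h2); apply: nearW.
- exact: ig.
- apply: aeW => x n _ /=; rewrite lee_fin ger0_norm ?sqr_ge0//.
move: h; rewrite integral0 => /fine_cvgP[h1 /cvgrPdist_lt/(_ e e0) h2].
near \oo => n; exists n.
have h3 : (\int[mu]_x ((fn n x - f x) ^+ 2)%:E \is a fin_num)%E.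
  by near: n; move: h1.
have h4 : `|0 - fine (\int[mu]_x ((fn n x - f x) ^+ 2)%:E)%E| < e by near: n; exact: h2.
rewrite /sqdist; under eq_integral => x _ do rewrite -sqrrN opprB.
rewrite -(fineK h3) lte_fin; apply: le_lt_trans h4.
by rewrite sub0r normrN ler_norm.
Unshelve. all: by end_near. Qed.

End L2.

(** * Density of the functions of finitely many digits *)

Section density.
Variable R : realType.
Local Notation T := (measurableTypeR R).
Local Notation mu := (@lebesgue01 R).
Local Notation leb := (@lebesgue_measure R).

Definition clip (M y : R) := Num.max (- M) (Num.min M y).

Lemma clip_norm M y : 0 <= M -> `|clip M y| <= M.
Proof.
move=> M0; rewrite /clip ler_norml; apply/andP; split; first by rewrite le_max lexx.
by rewrite ge_max ge_min lexx /= andbT; lra.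
Qed.

Lemma clip_id M y : `|y| <= M -> clip M y = y.
Proof. by rewrite ler_norml /clip => /andP[h1 h2]; rewrite min_r// max_r. Qed.

(** A case principle with linear side conditions, which reduces inequalities about [clip] to
    [lra]. *)
Lemma clipE M y (P : R -> Prop) :
  (M <= y -> M <= - M -> P (- M)) -> (M <= y -> - M <= M -> P M) ->
  (y <= M -> y <= - M -> P (- M)) -> (y <= M -> - M <= y -> P y) -> P (clip M y).
Proof.
rewrite /clip => h1 h2 h3 h4; have [a|/ltW a] := leP M y.
  by have [/ltW b|b] := ltP M (- M); [exact: h1|exact: h2].
by have [/ltW b|b] := ltP y (- M); [exact: h3|exact: h4].
Qed.

Lemma clip_lip M y z : `|clip M y - clip M z| <= `|y - z|.
Proof.
rewrite ler_norml; have := ler_norm (y - z); have := ler_norm (z - y).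
rewrite (distrC z y); set d := `|y - z| => h1 h2; have d0 : 0 <= d by exact: normr_ge0.
by apply: (clipE (P := fun c => - d <= c - _ <= d)) => ? ?;
  apply: (clipE (P := fun c => - d <= _ - c <= d)) => ? ?; apply/andP; split; lra.
Qed.

Lemma clip_sub M y : 0 <= M -> `|clip M y - y| <= `|y|.
Proof.
move=> M0; have h1 := ler_norm y; have := ler_norm (- y); rewrite normrN => h2.
have := normr_ge0 y; rewrite ler_norml; move: `|y| h1 h2 => d h1 h2 d0.
by apply: (clipE (P := fun c => - d <= c - _ <= d)) => ? ?; apply/andP; split; lra.
Qed.

Lemma measurable_clip M (f : T -> R) : measurable_fun setT f ->
  measurable_fun setT (fun x => clip M (f x)).
Proof.
by move=> mf; apply: measurable_maxr; [exact: measurable_cst|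
  apply: measurable_minr => //; exact: measurable_cst].
Qed.

Lemma chunk_dig m (x : T) : 0 <= x < 1 -> chunk 0 m (dig x) = Num.trunc (2 ^+ m * x).
Proof.
move=> /andP[x0 x1]; elim: m => [|m IH] /=.
  by rewrite expr0 mul1r; apply/esym/truncn0Pn; rewrite -ltNge.
rewrite IH add0n /dig -[RHS]odd_double_half addnC; congr (_ + _.*2)%N.
by rewrite exprS -mulrA trunc_half// mulr_ge0// exprn_ge0.
Qed.

Lemma dyadic_cvg (x : T) : 0 <= x < 1 ->
  (fun m => (chunk 0 m (dig x))%:R / 2 ^+ m : R) @ \oo --> x.
Proof.
move=> hx; have /andP[x0 x1] := hx; apply/cvgrPdist_le => e e0.
have /cvgrPdist_le/(_ e e0) := @cvg_geometric R 1 2^-1 (ltac:(rewrite ger0_norm; lra)).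
apply: filterS => m; rewrite sub0r normrN /geometric /= mul1r => h.
have m0 : 0 < 2 ^+ m :> R by rewrite exprn_gt0.
apply: le_trans h; rewrite exprVn chunk_dig//.
have /andP[] := truncn_itv (mulr_ge0 (ltW m0) x0); move: (Num.trunc _) => n h1 h2.
rewrite [leRHS]ger0_norm ?invr_ge0 ?(ltW m0)// ler_norml.
have -> : x - n%:R / 2 ^+ m = (2 ^+ m * x - n%:R) / 2 ^+ m by field; exact: lt0r_neq0.
apply/andP; split; first by rewrite (@le_trans _ _ 0)// ?oppr_le0 ?invr_ge0 ?divr_ge0 ?subr_ge0// ltW.
rewrite -[leRHS]mul1r ler_pM2r ?invr_gt0// lerBlDl; apply: ltW.
by rewrite natr1.
Qed.

(** [g] is evaluated at the dyadic point obtained from [x] by keeping its first [m] digits. *)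
Lemma dense_cont (M : R) (g : T -> R) : continuous (g : R -> R) -> 0 <= M ->
  forall e : R, 0 < e -> exists m F, dep m F /\ (sqdist (fun x => clip M (g x)) (F \o @dig R) < e%:E)%E.
Proof.
move=> cg M0 e e0.
pose F m (w : digits) := clip M (g ((chunk 0 m w)%:R / 2 ^+ m)).
have dF m : dep m (F m).
  move=> w w' ww; rewrite /F (@eq_chunk 0 m w w')// => i hi; apply: ww; lia.
have mg : measurable_fun setT (fun x : T => clip M (g x)).
  by apply: measurable_clip; exact: continuous_measurable_fun.
have [|||n hn] := @sqdist_cvg R (fun x => clip M (g x)) (fun m => F m \o @dig R)
    (cst ((2 * M) ^+ 2)) mg (fun m => measurable_dep (dF m)) _ _ _ e e0.
- apply: filterS (@ae_01 R) => x hx; apply/cvgrPdist_le => d d0.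
  have h := dyadic_cvg hx.
  have : (fun m => g ((chunk 0 m (dig x))%:R / 2 ^+ m)) @ \oo --> g x.
    by apply: (cvg_comp _ _ h); exact: cg.
  move=> /cvgrPdist_le/(_ d d0); apply: filterS => m h2; apply: le_trans h2.
  exact: clip_lip.
- apply: (@bounded_integrable01 _ _ ((2 * M) ^+ 2)); first exact: measurable_cst.
  by move=> x; rewrite ger0_norm ?sqr_ge0.
- move=> m x /=; rewrite -[leLHS]real_normK ?num_real// ler_pXn2r ?nnegrE ?mulr_ge0//.
  apply: le_trans (ler_normB _ _) _; rewrite /F.
  have := clip_norm (g x) M0; have := clip_norm (g ((chunk 0 m (dig x))%:R / 2 ^+ m)) M0; lra.
by exists n, (F n).
Qed.

(** Continuous functions approximate [f] in mean; clipping them at [M] upgrades this to mean square,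
    since a squared error is at most [2 * M] times the unclipped error. The tolerance [e / (8 * M)]
    thus becomes [e / 4]. *)
Lemma dense_bounded (M : R) (f : T -> R) : measurable_fun setT f -> 0 < M ->
  (forall x, `|f x| <= M) ->
  forall e : R, 0 < e -> exists m F, dep m F /\ (sqdist f (F \o @dig R) < e%:E)%E.
Proof.
move=> mf M0 fM e e0.
have m01 : measurable (`[0%R, 1%R]%classic : set T) by exact: measurable_itv.
have l01 : (leb (`[0%R, 1%R]%classic : set T) < +oo)%E.
  by rewrite lebesgue_measure_itv /= lte_fin ltr01 -EFinD ltry.
have intf : leb.-integrable `[0%R, 1%R] (EFin \o f).
  apply: measurable_bounded_integrable => //; first exact: measurable_funTS.
  exists M; split; first exact: num_real.
  by move=> N MN x _ /=; rewrite (le_trans (fM x))// ltW.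
have [g [cg ig cv]] := @approximation_continuous_integrable R `[0%R, 1%R] f m01 l01 intf.
have d0 : 0 < e / (8 * M) by rewrite divr_gt0// mulr_gt0.
have [n hn] : exists n, (\int[leb]_(z in `[0%R, 1%R]) `|(f z - g n z)%:E| < (e / (8 * M))%:E)%E.
  move: cv => /fine_cvgP[h1 /cvgrPdist_lt/(_ _ d0) h2].
  near \oo => n; exists n.
  have h3 : (\int[leb]_(z in `[0%R, 1%R]) `|(f z - g n z)%:E| \is a fin_num)%E.
    by near: n; exact: h1.
  have h4 : `|0 - fine (\int[leb]_(z in `[0%R, 1%R]) `|(f z - g n z)%:E|)%E| < e / (8 * M).
    by near: n; exact: h2.
  rewrite -(fineK h3) lte_fin; apply: le_lt_trans h4.
  by rewrite sub0r normrN ler_norm.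
have mgn : measurable_fun setT (g n : T -> R) by exact: continuous_measurable_fun.
have mc : measurable_fun setT (fun x => clip M (g n x)) by exact: measurable_clip.
have e4 : 0 < e / 4 by rewrite divr_gt0.
have [m [F [dF hF]]] := dense_cont (cg n) (ltW M0) e4.
exists m, F; split => //.
apply: le_lt_trans (sqdist_tri mf mc (measurable_dep dF)) _.
have h1 : (sqdist f (fun x => clip M (g n x)) < (e / 4)%:E)%E.
  rewrite /sqdist; apply: (@le_lt_trans _ _ (\int[mu]_x ((2 * M)%:E * `|(f x - g n x)%:E|))%E).
    apply: ge0_le_integral => //.
    - by move=> x _; rewrite lee_fin sqr_ge0.
    - by apply/measurable_EFinP; apply: measurable_funX; exact: measurable_funB.
    - apply: measurable_funeM; apply: measurableT_comp => //; apply/measurable_EFinP.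
      exact: measurable_funB.
    - move=> x _; rewrite /= -EFinM lee_fin -[leLHS]real_normK ?num_real// expr2.
      have h2 : `|f x - clip M (g n x)| <= `|f x - g n x|.
        by rewrite -[X in `|X - _|](clip_id (fM x)); exact: clip_lip.
      apply: ler_pM => //; apply: le_trans (ler_normB _ _) _.
      have := fM x; have := clip_norm (g n x) (ltW M0); lra.
  have mi : measurable_fun setT (fun x : T => `|(f x - g n x)%:E|%E).
    by apply: measurableT_comp => //; apply/measurable_EFinP; exact: measurable_funB.
  rewrite ge0_integralZl// ?lee_fin; last by rewrite mulr_ge0// ltW.
  rewrite integral01//; apply: (@lt_le_trans _ _ ((2 * M)%:E * (e / (8 * M))%:E)%E).
    by rewrite lte_pmul2l ?lte_fin ?mulr_gt0.
  rewrite -EFinM lee_fin le_eqVlt; apply/orP; left; apply/eqP; field.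
  exact: lt0r_neq0.
apply: (@lt_le_trans _ _ (2%:E * (e / 4)%:E + 2%:E * (e / 4)%:E)%E); last first.
  by rewrite -!EFinM -EFinD lee_fin; lra.
by apply: lteD; rewrite lte_pmul2l.
Unshelve. all: by end_near. Qed.

Lemma dense_dep (h : T -> R) : h \in Lfun mu 2%:E ->
  forall e : R, 0 < e -> exists m F, dep m F /\ (sqdist h (F \o @dig R) < e%:E)%E.
Proof.
move=> hL e e0; have [mh _] := (Lfun2P h).1 hL.
have e4 : 0 < e / 4 by rewrite divr_gt0.
have mc n : measurable_fun setT (fun x => clip n.+1%:R (h x)) by exact: measurable_clip.
have [|||n hn] := @sqdist_cvg R h (fun n x => clip n.+1%:R (h x)) (fun x => h x ^+ 2) mh mc _ _ _
  (e / 4) e4.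
- apply: aeW => x; apply: cvg_near_cst; near=> n.
  apply: clip_id; near: n.
  exists (Num.trunc `|h x|) => // n /= hn; apply: le_trans (ltW (truncnS_gt _)) _.
  by rewrite ler_nat.
- exact: Lfun2_integrable_sqr.
- move=> n x; rewrite -[leLHS]real_normK ?num_real// -[leRHS]real_normK ?num_real//.
  by rewrite ler_pXn2r ?nnegrE//; exact: clip_sub.
have [m [F [dF hF]]] := dense_bounded (mc n) (ltr0Sn R n) (fun x => clip_norm (h x) (ler0n R n.+1)) e4.
exists m, F; split => //.
apply: le_lt_trans (sqdist_tri mh (mc n) (measurable_dep dF)) _.
apply: (@lt_le_trans _ _ (2%:E * (e / 4)%:E + 2%:E * (e / 4)%:E)%E); last first.
  by rewrite -!EFinM -EFinD lee_fin; lra.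
by apply: lteD; rewrite lte_pmul2l.
Unshelve. all: by end_near. Qed.

End density.

Section walsh_sum.
Variable R : realFieldType.

Lemma mean_odd_walsh_sum (c : nat -> R) K :
  mean (fun w => (\sum_(k < K) c k * walsh R (2 * k).+1 w) ^+ 2) (\sum_(k < K) c k ^+ 2).
Proof.
elim: K => [|K IH].
  rewrite big_ord0; congr mean: (@mean0 R); apply/funext => w; by rewrite big_ord0 expr0n.
have s1 : spec (fun n => exists2 k, (k < K)%N & n = (2 * k).+1)
    (fun w => \sum_(k < K) c k * walsh R (2 * k).+1 w).
  apply: (@spec_sum _ _ _ (fun k w => c k * walsh R (2 * k).+1 w)) => k kK.
  have h : spec (fun n => exists2 k, (k < K)%N & n = (2 * k).+1) (walsh R (2 * k).+1).
    by apply: (@spec_walsh R (fun n => exists2 k, (k < K)%N & n = (2 * k).+1)); exists k.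
  have := spec_lin (c k) 0 h h; congr spec; apply/funext => w; by rewrite mul0r addr0.
have s2 : spec (eq (2 * K).+1) (walsh R (2 * K).+1) by exact: (@spec_walsh R (eq (2 * K).+1)).
have h0 : mean (fun w => (\sum_(k < K) c k * walsh R (2 * k).+1 w) * walsh R (2 * K).+1 w) 0.
  apply: (spec_orth _ s1 s2) => n [k kK ->] e; move: e kK; lia.
have := mean_lin 1 (c K ^+ 2) (mean_lin 1 (2 * c K) IH h0) (mean_walsh R (2 * K).+1 (2 * K).+1).
rewrite eqxx mulr0 addr0 !mul1r mulr1 big_ord_recr /=; congr mean; apply/funext => w.
rewrite big_ord_recr /=; ring.
Qed.

End walsh_sum.

(** * Translation by one half *)

Section translation.
Variable R : realType.
Local Notation T := (measurableTypeR R).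
Local Notation mu := (@lebesgue01 R).
Local Notation leb := (@lebesgue_measure R).

Let shift_meas (h : R) : measurable_fun setT (fun x : T => x + h : T).
Proof. by apply: measurable_funD => //; exact: measurable_cst. Qed.

Lemma lebesgue_shift (h : R) (A : set T) : measurable A ->
  leb ((fun x : T => x + h) @^-1` A) = leb A.
Proof.
move=> mA; apply/esym.
pose m0 := [the {measure set T -> \bar R} of pushforward leb (fun x : T => x + h : T)].
pose m := m0 (shift_meas h).
suff H X : ocitv X -> leb X = m X by exact: (lebesgue_measure_unique H mA).
move=> [[a b] _ <-].
rewrite /= /pushforward.
have -> : (fun x : T => x + h) @^-1` `]a, b]%classic = `]a - h, b - h]%classic.
  by apply/seteqP; split => x /=; rewrite !in_itv /= ltrBlDr lerBrDr.
rewrite !lebesgue_measure_itv /= !lte_fin ltrD2r.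
case: ifP => // _; rewrite -!EFinD; congr EFin; ring.
Qed.

Lemma ae_half_shift (P : T -> Prop) : {ae mu, forall x, P x} ->
  {ae mu, forall x, 0 <= x < 2^-1 -> P (x + 2^-1)}.
Proof.
move=> [N [mN N0 PN]].
(* A null set of [mu] may have positive Lebesgue measure outside [[0, 1]], so it is cut down before
   being shifted. *)
pose N1 := N `&` `[0%R, 1%R]%classic.
have mN1 : measurable N1 by apply: measurableI => //; exact: measurable_itv.
have e0 : leb ((fun x : T => x + 2^-1) @^-1` N1) = 0%E by rewrite lebesgue_shift.
have mS : measurable ((fun x : T => x + 2^-1) @^-1` N1).
  by rewrite -[X in measurable X]setTI; exact: shift_meas.
exists ((fun x : T => x + 2^-1) @^-1` N1); split => //.
  apply/eqP; rewrite eq_le measure_ge0 andbT -e0 /= /lebesgue01 /mrestr.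
  apply: le_measure; rewrite ?inE//; apply: measurableI => //; exact: measurable_itv.
move=> x /= /not_implyP[/andP[x0 x1] nP]; split; first exact: PN.
by rewrite /= in_itv /=; apply/andP; split; lra.
Qed.

(** The shift adds [2 ^ i] to the integer whose parity is digit [i], and this is odd only for
    [i = 0]. *)
Lemma dig_half (x : T) : 0 <= x -> dig (x + 2^-1) = flip 0 (dig x) .
Proof.
move=> x0; apply/funext => i; rewrite /flip /upd /dig.
have e : 2 ^+ i.+1 * (x + 2^-1) = (2 ^ i)%:R + 2 ^+ i.+1 * x :> R.
  by rewrite natrX exprS; field.
rewrite e truncnD ?natr_nat ?qualifE /= ?mulr_ge0 ?exprn_ge0// natrK oddD.
by case: i {e} => [|i] //=; rewrite oddX.
Qed.

End translation.

(** * The system on the unit interval and the bound on its root coefficients *)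

Section theta.
Variable R : realType.
Variable n_ : nat -> nat.
Hypothesis n_gt0 : forall k, (0 < n_ k)%N.
Hypothesis n_big : forall k, 21504 * k.+1%:R ^+ 4 <= (n_ k)%:R :> R.
Local Notation T := (measurableTypeR R).
Local Notation mu := (@lebesgue01 R).

Definition theta n (x : T) : R := sys R n_ n (dig x).

Lemma measurable_theta n : measurable_fun setT (theta n).
Proof. by have [m dm] := dep_sys R n_ n; exact: measurable_dep dm. Qed.

Lemma integral_mean (f : digits -> R) e : mean f e -> (\int[mu]_x (f (dig x))%:E = e%:E)%E.
Proof. by move=> [m [dm <-]]; exact: integral_dig. Qed.

Lemma theta_orthonormal : orthonormal_system theta.
Proof.
split=> [n|m n]; last exact: (integral_mean (mean_sys R n_ m n)).
by apply: (@bounded_Lfun2 R _ 5); [exact: measurable_theta|move=> x; exact: sys_bound].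
Qed.

Lemma theta_bounded : uniformly_bounded theta.
Proof.
apply: (@le_lt_trans _ _ 5%:E); last exact: ltry.
apply: ub_ereal_sup => _ [n _ <-]; rewrite unlock /Lnorm; case: ifP => _; last by rewrite lee_fin.
apply/ess_supP; apply: nearW => x /=; rewrite lee_fin; exact: sys_bound.
Qed.

Lemma linear_span_lin (a b : R) f g : linear_span theta f -> linear_span theta g ->
  linear_span theta (fun x => a * f x + b * g x).
Proof.
have ext N (c : nat -> R) M x : (N <= M)%N -> \sum_(n < N) c n * theta n x =
    \sum_(n < M) (if (n < N)%N then c n else 0) * theta n x.
  move=> NM; rewrite (big_ord_widen M (fun n => c n * theta n x) NM) big_mkcond /=.
  by apply: eq_bigr => n _; case: ifP => _; rewrite ?mul0r.
move=> [N [c ->]] [N' [c' ->]].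
exists (N + N')%N, (fun n => a * (if (n < N)%N then c n else 0) + b * (if (n < N')%N then c' n else 0)).
apply/funext => x; rewrite (ext N c (N + N')%N) ?leq_addr// (ext N' c' (N + N')%N) ?leq_addl//.
rewrite !mulr_sumr -big_split /=; apply: eq_bigr => n _.
by rewrite mulrDl !mulrA.
Qed.

Lemma linear_span_dep m (F : digits -> R) : dep m F -> linear_span theta (F \o @dig R).
Proof.
move=> dF; apply: (@sys_dep R n_ (fun f => linear_span theta (f \o @dig R)) _ _ m F dF).
  by move=> a b f g hf hg; exact: linear_span_lin.
move=> n; exists n.+1, (fun i => (i == n)%:R); apply/funext => x.
rewrite big_ord_recr /= eqxx mul1r big1 ?add0r// => i _.
by rewrite ltn_eqF ?mul0r.
Qed.

Lemma theta_complete : complete_system theta.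
Proof.
rewrite /complete_system; apply/seteqP; split => h; first by case.
move=> hL; split=> // e e0.
have [m [F [dF hF]]] := dense_dep hL (exprn_gt0 2 e0).
exists (F \o @dig R); first exact: linear_span_dep dF.
exact: Lnorm2_lt.
Qed.

Section divergence.
Variable a : nat -> R.

Lemma series_psum N x : series (fun n => a n * theta n x) N = psum n_ a N (dig x).
Proof. by rewrite /series /psum /= big_mkord. Qed.

Definition goodset k0 K : set T := [set x | goods n_ a k0 K (dig x)].

Let dep_goodsR k0 K : dep (start n_ K) (fun w => (goods n_ a k0 K w)%:R : R).
Proof. by move=> w w' ww; rewrite (dep_goods a k0 ww). Qed.

Lemma measurable_goodset k0 K : measurable (goodset k0 K).
Proof.
have := measurable_dep (@dep_goodsR k0 K) measurableT (measurable_set1 1).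
rewrite setTI; congr measurable; apply/seteqP; split => x /=; rewrite /goodset /=.
  by case: (goods _ _ _ _ _) => // /eqP; rewrite mulr0n eq_sym oner_eq0.
by move=> ->.
Qed.

Lemma mu_goodset k0 K :
  mu (goodset k0 K) = (expct (start n_ K) (fun w => (goods n_ a k0 K w)%:R : R))%:E.
Proof.
rewrite -(integral_dig (@dep_goodsR k0 K)) -[LHS]/(mu _) -[goodset k0 K]setIT.
rewrite -(integral_indic mu measurableT (measurable_goodset k0 K)).
apply: eq_integral => x _; rewrite indicE; congr (_%:R%:E); congr nat_of_bool.
by apply/idP/idP => [/set_mem|/mem_set].
Qed.

Definition conv_at (f : T -> R) (x : T) := (fun N => psum n_ a N (dig x)) @ \oo --> f x.

(** Once partial sums are within 1/2 of the limit, any two of them differ by at most 1. *)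
Lemma conv_goods f x : conv_at f x -> exists k0, forall K, goodset k0 K x.
Proof.
move=> cx; have [k0 _ hk0] := (cvgrPdist_le _ _).1 cx 2^-1 (ltac:(lra)).
exists k0 => K; apply/forallP => k; apply/implyP => kk; apply/forallP => t /=.
have tT : (t <= width n_ k)%N by have := ltn_ord t; rewrite ltnS.
rewrite -psum_bsum//.
have h1 := hk0 (offs R n_ k + t)%N (leq_trans kk (leq_trans (offs_ge R n_ k) (leq_addr _ _))).
have h2 := hk0 (offs R n_ k) (leq_trans kk (offs_ge R n_ k)).
rewrite (_ : psum n_ a _ _ - _ = f x - psum n_ a (offs R n_ k) (dig x) -
  (f x - psum n_ a (offs R n_ k + t)%N (dig x))); last by ring.
apply: le_trans (ler_normB _ _) _; have := lerD h2 h1; lra.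
Qed.

(** The increasing sets [B k0] exhaust almost all of the interval, so one of them has measure at
    least [1999 / 2000], as [sum_root_coef] requires. *)
Lemma root_coef_bounded f : {ae mu, forall x, conv_at f x} ->
  exists C : R, forall K, \sum_(k < K) root_coef n_ a k ^+ 2 <= C.
Proof.
move=> cf; pose B k0 : set T := \bigcap_K goodset k0 K.
have mB k0 : measurable (B k0) by apply: bigcap_measurable => // K _; exact: measurable_goodset.
have mUB : measurable (\bigcup_k0 B k0) by exact: bigcupT_measurable.
have muUB : (1 <= mu (\bigcup_k0 B k0))%E.
  case: cf => N [mN N0 hN]; rewrite -(lebesgue01_setT R).
  apply: (@le_trans _ _ (mu ((\bigcup_k0 B k0) `|` N))).
    apply: le_measure; rewrite ?inE//; first exact: measurableU.
    move=> x _; have [cx|ncx] := pselect (conv_at f x); last by right; exact: hN.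
    by left; have [k0 h] := conv_goods cx; exists k0 => // K _; exact: h.
  by apply: le_trans (measureU2 _ _ _) _ => //; rewrite [X in (_ + X)%E]N0 adde0.
have [k0 hk0] : exists k0, ((1999 / 2000)%:E <= mu (B k0))%E.
  apply: contrapT => /forallNP H.
  have cv : (mu \o B) @ \oo --> mu (\bigcup_k0 B k0).
    apply: nondecreasing_cvg_mu => // i j ij; apply/subsetPset => x hx K _.
    apply/forallP => k; apply/implyP => jk; have /forallP/(_ k)/implyP := hx K I; apply.
    exact: leq_trans ij jk.
  have h1 : (mu (\bigcup_k0 B k0) <= (1999 / 2000)%:E)%E.
    apply: cvge_to_le cv _; apply: nearW => k /=; rewrite leNgt; apply/negP => /ltW; exact: H.
  by have := le_trans muUB h1; rewrite lee_fin; lra.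
exists (\sum_(k < k0) root_coef n_ a k ^+ 2 + 4) => K.
have h K' : 1999 / 2000 <= expct (start n_ K') (fun w => (goods n_ a k0 K' w)%:R : R).
  rewrite -lee_fin -mu_goodset; apply: le_trans hk0 _.
  by apply: le_measure; rewrite ?inE//; [exact: measurable_goodset|move=> x; apply].
have S := @sum_root_coef R n_ a n_gt0 n_big k0 h K.
rewrite -!(big_mkord xpredT (fun k => root_coef n_ a k ^+ 2)).
have [kK|kK] := leqP k0 K; first by rewrite (big_cat_nat (n := k0))//= lerD2l.
rewrite [X in X + 4](big_cat_nat (n := K))//=; last exact: ltnW.
rewrite -addrA lerDl addr_ge0// sumr_ge0// => i _; exact: sqr_ge0.
Qed.

End divergence.
End theta.

(** * Failure of representation *)

Section nonrepresentation.
Variable R : realType.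
Variable n_ : nat -> nat.
Hypothesis n_gt0 : forall k, (0 < n_ k)%N.
Hypothesis n_big : forall k, 21504 * k.+1%:R ^+ 4 <= (n_ k)%:R :> R.
Local Notation T := (measurableTypeR R).
Local Notation mu := (@lebesgue01 R).

Lemma root_series_cvg (a : nat -> R) (f : T -> R) :
  {ae mu, forall x, conv_at n_ a f x} ->
  {ae mu, forall x, 0 <= x < 2^-1 ->
    (fun K => 2 * \sum_(k < K) root_coef n_ a k * walsh R (2 * k).+1 (dig x)) @ \oo
      --> f x - f (x + 2^-1)}.
Proof.
move=> cf; have := ae_half_shift cf; apply: filterS2 cf => x h2 h1 hx.
have {}h1 := h1 hx; have /andP[x0 _] := hx.
have sub (y : T) : conv_at n_ a f y -> (fun K => psum n_ a (offs R n_ K) (dig y)) @ \oo --> f y.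
  move=> /cvgrPdist_le h; apply/cvgrPdist_le => e e0; have [N _ hN] := h e e0.
  exists N => // K NK; apply: hN => /=; exact: leq_trans (offs_ge R n_ K).
rewrite (_ : (fun K => 2 * _) = (fun K => psum n_ a (offs R n_ K) (dig x) -
   psum n_ a (offs R n_ K) (dig (x + 2^-1)))).
  by apply: cvgB; exact: sub.
by apply/funext => K; rewrite dig_half// psum_flip.
Qed.

(* With [f x = x^-1], [f x - f (x + 2^-1)] is not square integrable at [0],
   whereas the Walsh sums converging to it are bounded in [L^2]. *)
Lemma theta_not_representing : ~ represents_all_measurable (theta (R := R) n_).
Proof.
move=> H; pose f (x : T) : R := x `^ (-1).
have mf : measurable_fun setT f by exact: measurable_powR.
have [||a ha] := H (EFin \o f).
- by apply/measurable_EFinP; exact: measurable_funTS.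
- exact: aeW.
have cf : {ae mu, forall x, conv_at n_ a f x}.
  apply: filterS ha => x /fine_cvgP[_]; apply: cvg_trans; apply: near_eq_cvg.
  by apply: nearW => N /=; rewrite series_psum.
have [C hC] := root_coef_bounded n_gt0 n_big cf.
have cv := root_series_cvg cf.
pose u K w : R := \sum_(k < K) root_coef n_ a k * walsh R (2 * k).+1 w.
(* Chosen to contradict the final estimate [2 ^ j / 2 <= 2 + 8 * C]. *)
have [j hj] : exists j : nat, 4 + 16 * C < 2 ^+ j.
  exists (Num.trunc (4 + 16 * C)).+1; apply: lt_le_trans (truncnS_gt _) _.
  by rewrite -natrX ler_nat ltnW// ltn_expl.
(* On [E], [f x >= 4 * 2 ^ j] and [f (x + 1/2) <= 2], so the difference is at least [A]; and [A ^ 2]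
   times the measure of [E] is [2 ^ j / 2]. Index 1 keeps [E] away from 0. *)
pose A : R := 2 ^+ j.+1; pose E : set T := dyad (j + 3) 1.
have A0 : 0 <= A by rewrite exprn_ge0.
have mE : measurable E by exact: measurable_dyad.
pose f0 (x : T) : R := A * \1_E x.
(* Clipping supplies the domination that turns pointwise into mean square convergence; the limit on
   [E] becomes exactly [A], and no modulus increases. *)
pose fn K (x : T) : R := \1_E x * clip A (2 * u K (dig x)).
have mu_ K : measurable_fun setT (fun x : T => 2 * u K (dig x)).
  have [m dm] : exists m, dep m (u K).
    exists (2 * K).+1 => w w' ww; apply: eq_bigr => -[k kK] _ /=; congr (_ * _).
    have h : ((2 * k).+1 < 2 ^ (2 * k).+1)%N by exact: ltn_expl.
    by apply: (walsh_dep R h) => i hi; apply: ww;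
      rewrite (leq_trans hi)// ltnS leq_mul2l ltnW.
  by apply: measurable_funM; [exact: measurable_cst|exact: measurable_dep dm].
have mf0 : measurable_fun setT f0.
  by apply: measurable_funM; [exact: measurable_cst|exact: measurable_indic].
have mfn K : measurable_fun setT (fn K).
  by apply: measurable_funM; [exact: measurable_indic|exact: measurable_clip].
have fn_le K x : fn K x ^+ 2 <= (2 * u K (dig x)) ^+ 2.
  rewrite -[leLHS]real_normK ?num_real// -[leRHS]real_normK ?num_real//.
  rewrite ler_pXn2r ?nnegrE// /fn normrM.
  have h1 : `|\1_E x : R| <= 1 by rewrite indicE; case: (_ \in _); rewrite ?normr1 ?normr0.
  have h2 : `|clip A (2 * u K (dig x))| <= `|2 * u K (dig x)|.
    have := clip_lip A (2 * u K (dig x)) 0; rewrite subr0.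
    by rewrite (@clip_id R A 0) ?normr0// subr0.
  by rewrite -[leRHS]mul1r; apply: ler_pM.
have [|||K hK] := @sqdist_cvg R f0 fn (cst ((2 * A) ^+ 2)) mf0 mfn _ _ _ 1 ltr01.
- move: cv; apply: filterS; first exact: (ae_filter_ringOfSetsType mu).
  move=> x hx; rewrite /f0 /fn /=.
  have [xE|xE] := pselect (E x); last first.
    by rewrite indicE memNset//= mulr0; under eq_fun do rewrite mul0r; exact: cvg_cst.
  rewrite indicE mem_set//= mulr1; under eq_fun do rewrite mul1r.
  have /andP[e1 e2] := xE.
  have q0 : 0 < 2 ^+ j :> R by rewrite exprn_gt0.
  have q1 : 1 <= 2 ^+ j :> R by rewrite exprn_ege1// ler1n.
  have eq8 : 2 ^+ (j + 3) = 8 * 2 ^+ j :> R by rewrite exprD mulrC; congr (_ * _); ring.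
  have x0 : 0 < x by rewrite (lt_le_trans _ e1)// divr_gt0// exprn_gt0.
  have x4 : x * (4 * 2 ^+ j) < 1.
    move: e2; rewrite eq8 ltr_pdivlMr; last by rewrite mulr_gt0.
    by move=> e2; lra.
  have xh : 0 <= x < 2^-1.
    rewrite ltW//=; nra.
  have {}hx := hx xh.
  have fx : 4 * 2 ^+ j <= f x.
    rewrite /f powR_inv1 ?(ltW x0)// -div1r ler_pdivlMr// mulrC; exact: ltW.
  have fx2 : f (x + 2^-1) <= 2.
    rewrite /f powR_inv1; last by lra.
    by rewrite invf_ple ?posrE; lra.
  have gA : A <= f x - f (x + 2^-1) by rewrite /A exprS; lra.
  have cA : clip A (f x - f (x + 2^-1)) = A.
    by rewrite /clip min_l// max_r//; lra.
  apply/cvgrPdist_le => e e0; move: hx => /cvgrPdist_le/(_ e e0).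
  by apply: filterS => K h; rewrite -{1}cA; apply: le_trans (clip_lip _ _ _) h.
- apply: (@bounded_integrable01 _ _ ((2 * A) ^+ 2)); first exact: measurable_cst.
  by move=> x; rewrite ger0_norm ?sqr_ge0.
- move=> K x /=; rewrite -[leLHS]real_normK ?num_real// ler_pXn2r ?nnegrE ?mulr_ge0//.
  apply: le_trans (ler_normB _ _) _; rewrite /fn /f0 !normrM (ger0_norm A0).
  have h1 : `|\1_E x : R| <= 1 by rewrite indicE; case: (_ \in _); rewrite ?normr1 ?normr0.
  have h2 := clip_norm (2 * u K (dig x)) A0.
  have h3 : `|\1_E x : R| * `|clip A (2 * u K (dig x))| <= 1 * A by apply: ler_pM.
  have h4 : A * `|\1_E x : R| <= A * 1 by apply: ler_wpM2l.
  lra.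
have lhs : sqdist f0 (fun=> 0%R) = (2 ^+ j / 2)%:E.
  rewrite /sqdist; under eq_integral => x _.
    rewrite /f0 /= subr0 exprMn indicE.
    rewrite (_ : (_ \in E)%:R ^+ 2 = (x \in E)%:R :> R); last first.
      by case: (_ \in _); rewrite ?expr1n ?expr0n.
    rewrite -indicE EFinM; over.
  rewrite integralZl//; last exact: integrable_indic.
  rewrite integral_indic// setIT [X in (_ * X)%E](@mu_dyad R (j + 3) 1); last first.
    by rewrite -{1}(expn0 2) ltn_exp2l// addn3.
  rewrite -EFinM; congr EFin; rewrite /A exprD !exprS; field.
  by rewrite expf_neq0 ?pnatr_eq0.
have rhs : (sqdist (fn K) (fun=> 0%R) <= (4 * C)%:E)%E.
  rewrite /sqdist; apply: (@le_trans _ _ (\int[mu]_x (4%:E * ((u K (dig x)) ^+ 2)%:E))%E).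
    apply: ge0_le_integral => //.
    - by move=> x _; rewrite lee_fin sqr_ge0.
    - by apply/measurable_EFinP; apply: measurable_funX; apply: measurable_funB.
    - have := mu_ K; move=> mm; under eq_fun do rewrite -EFinM.
      apply/measurable_EFinP; rewrite (_ : (fun x => 4 * _) = (fun x : T => (2 * u K (dig x)) ^+ 2)).
        exact: measurable_funX.
      by apply/funext => x; rewrite exprMn; congr (_ * _); ring.
    - move=> x _; rewrite /= subr0 -EFinM lee_fin; apply: le_trans (fn_le K x) _.
      by rewrite exprMn le_eqVlt; apply/orP; left; apply/eqP; congr (_ * _); ring.
  have m2 : mean (fun w => 4 * (u K w) ^+ 2 + 0 * (u K w) ^+ 2)
     (4 * (\sum_(k < K) root_coef n_ a k ^+ 2) + 0 * (\sum_(k < K) root_coef n_ a k ^+ 2)).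
    by apply: mean_lin; exact: mean_odd_walsh_sum.
  under eq_integral => x _ do rewrite -EFinM -[4 * _]addr0 -[X in _ + X](mul0r (u K (dig x) ^+ 2)).
  rewrite (integral_mean m2) mul0r addr0 lee_fin ler_wpM2l//.
have := sqdist_tri mf0 (mfn K) (@measurable_cst _ _ T R setT 0).
rewrite lhs => h.
have h2 : ((2 ^+ j / 2)%:E <= 2%:E * 1%:E + 2%:E * (4 * C)%:E)%E.
  apply: le_trans h _; apply: leeD; rewrite lee_pmul2l//; exact: ltW.
move: h2; rewrite -!EFinM -EFinD lee_fin; lra.
Qed.

End nonrepresentation.

Section width.
Variable R : realType.

(** [2 ^ 15] is the least power of 2 above 21504. *)
Definition block_size k := (2 ^ 15 * k.+1 ^ 4)%N.

Lemma block_size_gt0 k : (0 < block_size k)%N.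
Proof. by rewrite muln_gt0 !expn_gt0. Qed.

Lemma block_size_ge k : 21504 * k.+1%:R ^+ 4 <= (block_size k)%:R :> R.
Proof.
rewrite natrM !natrX ler_wpM2r ?exprn_ge0// !exprS expr0; lra.
Qed.

End width.

Theorem mainTheorem2 (R : realType) :
  exists theta : nat -> measurableTypeR R -> R,
    orthonormal_system theta /\
    complete_system theta /\
    uniformly_bounded theta /\
    ~ represents_all_measurable theta.
Proof.
exists (theta block_size); split; first exact: theta_orthonormal.
split; first exact: theta_complete.
split; first exact: theta_bounded.
by apply: theta_not_representing; [exact: block_size_gt0|exact: block_size_ge].
Qed.
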